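(* Suppose that a univariate specialization $F_2(a;b_1,b_2;c_1,c_2;x(t),y(t))$ of Appell's $F_2(x,y)$ function satisfies a second order ordinary Fuchsian equation fully implied by the system $$x(1-x)F_{xx}-xyF_{xy}+(c_1-(a+b_1+1)x)F_x-b_1yF_y-ab_1F=0,$$ $$y(1-y)F_{yy}-xyF_{xy}+(c_2-(a+b_2+1)y)F_y-b_2xF_x-ab_2F=0 .$$ Then either the specialization is into the singular locus of the system, that is, into the union of the lines $$x=0,\quad x=1,\quad x=\infty,\quad y=0,\quad y=1,\quad y=\infty,\quad x+y=1$$ in $\mathbf P^1\times\mathbf P^1$, or (up to a change of the specialization variable) it is represented by one of the two functions $$F_2(a;b_1,b_2;2b_1,2b_2;\;x,\,2-x),\qquad F_2\!\left(b_1+b_2-\tfrac12;\,b_1,b_2;\,2b_1,2b_2;\;1-t^2,\;1-\frac{(t+s)^2}{s^2-1}\right),$$ where $s$ is a constant with $s^2\ne1$.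
   Context: $(\alpha)_n=\alpha(\alpha+1)\cdots(\alpha+n-1)$. Appell's function is (the analytic continuation of) $$F_2(a;b_1,b_2;c_1,c_2;x,y)=\sum_{n,m\ge 0}\frac{(a)_{n+m}(b_1)_n(b_2)_m}{(c_1)_n(c_2)_m\,n!\,m!}x^ny^m ,$$ a solution of the displayed system, which has rank 4. An ODE is Fuchsian if it is linear, homogeneous, with only regular singularities. Univariate specialization: for a (nonconstant) holomorphic map $\Phi:t\mapsto(x(t),y(t))$ from an open subset of $\mathbf C$ to $\mathbf C^2$, $F(x(t),y(t))=F\circ\Phi$. The partial differential form under $\Phi$ of an ODE $E$ in $t$ is obtained by replacing $t$-derivatives by partial derivatives via the chain rule: $\frac{dF}{dt}=\dot xF_x+\dot yF_y$, $\frac{d^2F}{dt^2}=\dot x^2F_{xx}+2\dot x\dot yF_{xy}+\dot y^2F_{yy}+\ddot xF_x+\ddot yF_y$, etc. The specialized form under $\Phi$ of a linear PDE is obtained by substituting $x=x(t),y=y(t)$ into the coefficients of the partial derivatives. $E$ follows fully from (is fully implied by) a PDE system $H$ under $\Phi$ if its partial differential form coincides with the specialized form of some PDE that follows from $H$ by algebraic and partial differentiation operations.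
   Formalization: The open set on which the specialization map is defined is assumed connected; on a disconnected open set the dichotomy can fail as stated (for example if the map is constant on one component) and holds only on each component where the map is nonconstant. *)

(* Defs.v *)
(* Stdlib reals with Coquelicot's complex numbers [C]. *)
From Stdlib Require Import Reals Factorial List.
From Coquelicot Require Import Coquelicot.
Open Scope R_scope.
Open Scope C_scope.

Definition connected {T : UniformSpace} (D : T -> Prop) : Prop :=
  forall U V : T -> Prop, open U -> open V ->
    (forall z, D z -> U z \/ V z) ->
    (exists z, D z /\ U z) -> (exists z, D z /\ V z) ->
    exists z, D z /\ U z /\ V z.

(** Holomorphic functions of one and two variables, in the sense of Weierstrass:
    locally the sum of a convergent power series. *)

Definition holomorphic (D : C -> Prop) (f : C -> C) : Prop :=
  forall z0, D z0 -> exists (a : nat -> C) (r : posreal),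
    forall z, (Cmod (z - z0) < r)%R -> is_pseries a (z - z0) (f z).

(* [g], possibly undefined at [z0] itself, extends holomorphically to [z0]. *)
Definition extends_at (z0 : C) (g : C -> C) : Prop :=
  exists (a : nat -> C) (r : posreal),
    forall z, (0 < Cmod (z - z0) < r)%R -> is_pseries a (z - z0) (g z).

(* Absolutely convergent double series; the first clause bounds the partial sums of moduli,
   so that the order of summation in the second one is immaterial. *)
Definition is_double_series (u : nat -> nat -> C) (l : C) : Prop :=
  (exists M : R, forall N : nat,
     (sum_n (fun n => sum_n (fun m => Cmod (u n m)) N) N <= M)%R) /\
  (exists v : nat -> C, (forall n, is_series (u n) (v n)) /\ is_series v l).

Definition holomorphic2 (U : C * C -> Prop) (g : C * C -> C) : Prop :=
  forall p0, U p0 -> exists (a : nat -> nat -> C) (r : posreal),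
    forall p, (Cmod (fst p - fst p0) < r)%R -> (Cmod (snd p - snd p0) < r)%R ->
      is_double_series
        (fun n m => a n m * (fst p - fst p0) ^ n * (snd p - snd p0) ^ m) (g p).

(** Appell's function F2 and its analytic continuation *)

Record params := Params { pa : C; pb1 : C; pb2 : C; pc1 : C; pc2 : C }.

Fixpoint poch (z : C) (n : nat) : C :=
  match n with
  | O => 1
  | S n' => poch z n' * (z + RtoC (INR n'))
  end.

Definition F2_coef (k : params) (n m : nat) : C :=
  (poch (pa k) (n + m) * poch (pb1 k) n * poch (pb2 k) m) /
  (poch (pc1 k) n * poch (pc2 k) m * RtoC (INR (fact n)) * RtoC (INR (fact m))).

(* No denominator of the series vanishes. *)
Definition F2_defined (k : params) : Prop :=
  forall n : nat, pc1 k <> - RtoC (INR n) /\ pc2 k <> - RtoC (INR n).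

Definition is_F2_series (k : params) (p : C * C) (l : C) : Prop :=
  is_double_series (fun n m => F2_coef k n m * fst p ^ n * snd p ^ m) l.

Definition function_element (U : C * C -> Prop) (G : C * C -> C) : Prop :=
  open U /\ connected U /\ holomorphic2 U G.

(* Function elements reached from the series, whose domain of convergence is |x| + |y| < 1,
   by finitely many direct analytic continuations. *)
Inductive F2_branch (k : params) : (C * C -> Prop) -> (C * C -> C) -> Prop :=
| F2_branch_series U G :
    function_element U G ->
    (forall p, U p -> (Cmod (fst p) + Cmod (snd p) < 1)%R /\ is_F2_series k p (G p)) ->
    F2_branch k U G
| F2_branch_continue U G V K :
    F2_branch k U G ->
    function_element V K ->
    (exists p, U p /\ V p /\ locally p (fun q => K q = G q)) ->
    F2_branch k V K.

(* [f] is a branch of t |-> F2(k; x(t), y(t)) on [D]: the map (x, y) lifts to a continuous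
   choice of germs of analytic continuations of F2, and [f] is the value of the chosen germ. *)
Definition F2_specialization (k : params) (D : C -> Prop) (x y f : C -> C) : Prop :=
  exists (U : C -> C * C -> Prop) (G : C -> C * C -> C),
    forall t, D t ->
      F2_branch k (U t) (G t) /\ U t (x t, y t) /\ f t = G t (x t, y t) /\
      locally t (fun t' => locally (x t', y t') (fun p => G t' p = G t p)).

(** Second order Fuchsian equations F'' + A F' + B F = 0 on the Riemann sphere *)

(* [S] contains the finite singularities. With t = 1/u, the conditions at u = 0 say that
   t A(t) and t^2 B(t) are holomorphic at infinity. *)
Definition fuchsian2 (A B : C -> C) (S : list C) : Prop :=
  holomorphic (fun t => ~ In t S) A /\
  holomorphic (fun t => ~ In t S) B /\
  (forall s, In s S ->
     extends_at s (fun t => (t - s) * A t) /\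
     extends_at s (fun t => (t - s) ^ 2 * B t)) /\
  extends_at 0 (fun u => / u * A (/ u)) /\
  extends_at 0 (fun u => (/ u) ^ 2 * B (/ u)).

Definition solves2 (A B : C -> C) (S : list C) (D : C -> Prop) (f : C -> C) : Prop :=
  forall t, D t -> ~ In t S ->
    C_derive (C_derive f) t + A t * C_derive f t + B t * f t = 0.

(** Linear partial differential equations *)

(* [L i j] is the coefficient of the derivative of F, i times in x and j times in y. *)
Definition pde := nat -> nat -> C * C -> C.

Definition pde_dx (L : pde) : pde := fun i j p =>
  C_derive (fun z => L i j (z, snd p)) (fst p) +
  match i with O => 0 | S i' => L i' j p end.

Definition pde_dy (L : pde) : pde := fun i j p =>
  C_derive (fun w => L i j (fst p, w)) (snd p) +
  match j with O => 0 | S j' => L i j' p end.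

Definition pde_add (L M : pde) : pde := fun i j p => L i j p + M i j p.

Definition pde_mul (g : C * C -> C) (L : pde) : pde := fun i j p => g p * L i j p.

Definition F2_eq1 (k : params) : pde := fun i j p =>
  let x := fst p in let y := snd p in
  match i, j with
  | 2%nat, 0%nat => x * (1 - x)
  | 1%nat, 1%nat => - (x * y)
  | 1%nat, 0%nat => pc1 k - (pa k + pb1 k + 1) * x
  | 0%nat, 1%nat => - (pb1 k * y)
  | 0%nat, 0%nat => - (pa k * pb1 k)
  | _, _ => 0
  end.

Definition F2_eq2 (k : params) : pde := fun i j p =>
  let x := fst p in let y := snd p in
  match i, j with
  | 0%nat, 2%nat => y * (1 - y)
  | 1%nat, 1%nat => - (x * y)
  | 0%nat, 1%nat => pc2 k - (pa k + pb2 k + 1) * y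
  | 1%nat, 0%nat => - (pb2 k * x)
  | 0%nat, 0%nat => - (pa k * pb2 k)
  | _, _ => 0
  end.

Inductive F2_prolongation (k : params) : pde -> Prop :=
| F2_prolongation_1 : F2_prolongation k (F2_eq1 k)
| F2_prolongation_2 : F2_prolongation k (F2_eq2 k)
| F2_prolongation_dx L : F2_prolongation k L -> F2_prolongation k (pde_dx L)
| F2_prolongation_dy L : F2_prolongation k L -> F2_prolongation k (pde_dy L).

(* Equations on [U] that follow from the F2 system: the left ideal that it generates in the ring
   of linear differential operators with holomorphic coefficients on [U]. Up to equality on [U],
   closure under differentiation holds by the Leibniz rule. *)
Inductive F2_follows (k : params) (U : C * C -> Prop) : pde -> Prop :=
| F2_follows_prolongation L : F2_prolongation k L -> F2_follows k U L
| F2_follows_add L M : F2_follows k U L -> F2_follows k U M -> F2_follows k U (pde_add L M)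
| F2_follows_mul g L :
    holomorphic2 U g -> F2_follows k U L -> F2_follows k U (pde_mul g L).

(* Partial differential form of F'' + A F' + B F under t |-> (x(t), y(t)). *)
Definition pd_form (A B x y : C -> C) (i j : nat) (t : C) : C :=
  let x' := C_derive x t in let x'' := C_derive (C_derive x) t in
  let y' := C_derive y t in let y'' := C_derive (C_derive y) t in
  match i, j with
  | 2%nat, 0%nat => x' ^ 2
  | 1%nat, 1%nat => 2 * x' * y'
  | 0%nat, 2%nat => y' ^ 2
  | 1%nat, 0%nat => x'' + A t * x'
  | 0%nat, 1%nat => y'' + A t * y'
  | 0%nat, 0%nat => B t
  | _, _ => 0
  end.

(* Two points are implicit in "the partial differential form coincides with a specialized form".
   Equations are taken up to a factor [h] of t. The coefficients of [L] may have singularities,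
   even on part of the curve; as both forms are meromorphic in t, it is enough to compare them on
   a nonempty open set [D'] along which [L] is defined. *)
Definition fully_implied2 (k : params) (D : C -> Prop) (x y A B : C -> C) : Prop :=
  exists (U : C * C -> Prop) (L : pde) (D' : C -> Prop) (h : C -> C),
    open U /\ F2_follows k U L /\
    open D' /\ (exists t, D' t) /\ (forall t, D' t -> D t /\ U (x t, y t)) /\
    holomorphic D' h /\ (forall t, D' t -> h t <> 0) /\
    forall t, D' t -> forall i j : nat, L i j (x t, y t) = h t * pd_form A B x y i j t.

(** The singular locus in P^1 x P^1, and reparametrization *)

Inductive P1 := Fin (z : C) | Inf.

Definition F2_singular (P Q : P1) : Prop :=
  P = Fin 0 \/ P = Fin 1 \/ P = Inf \/
  Q = Fin 0 \/ Q = Fin 1 \/ Q = Inf \/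
  (exists u v : C, P = Fin u /\ Q = Fin v /\ u + v = 1).

(* F2(k; x(t), y(t)) on [D] is F2(k'; X(w), Y(w)) with w = psi(t). *)
Definition represented_by (k : params) (D : C -> Prop) (x y : C -> C)
    (k' : params) (X Y : C -> C) : Prop :=
  k = k' /\
  exists psi : C -> C, holomorphic D psi /\
    (exists t1 t2, D t1 /\ D t2 /\ psi t1 <> psi t2) /\
    forall t, D t -> x t = X (psi t) /\ y t = Y (psi t).

(* Main.v *)
Require Import Defs.
From Stdlib Require Import Reals Factorial List Lra Lia Classical ClassicalEpsilon FunctionalExtensionality.
From Coquelicot Require Import Coquelicot.
Open Scope R_scope.
Open Scope C_scope.

(** The F2 system is integrable of rank 4: outside its singular locus the derivatives of F are
    combinations of F, F_x, F_y, F_xy, with no relation between these four. A consequence of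
    order 2 along the curve is therefore, at every regular point, a combination
    [lam * eq1 + mu * eq2] of the two equations. Comparing second order coefficients gives
    x'^2 = lam x (1 - x), y'^2 = mu y (1 - y), 2 x' y' = - (lam + mu) x y, hence
    y (1 - y) x'^2 + 2 (1 - x) (1 - y) x' y' + x (1 - x) y'^2 = 0.
    With x = 1 - u^2, y = 1 - v^2 this is Clairaut's equation u'^2 + v'^2 = (u' v - u v')^2 of the
    tangent lines of the circle u^2 + v^2 = 1, the circle itself being the line x + y = 1. The
    squared slope gives the first integral kap = (1 - y) x'^2 / ((1 - x) y'^2) = s^2 - 1, so that
    (y kap + x)^2 = 4 kap (1 - x) (1 - y); for s <> 0 the parameter u is a polynomial in x and y,
    and s = 0 is the line x + y = 2. Eliminating A from the first order coefficients then
    leaves a polynomial identity in the parameter, which yields the relations between a, b_i, c_i. *)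

(** * Complex differentiability and power series *)

(** Consequences of the system are handled algebraically, without solutions. [F2_follows] multiplies
    by holomorphic coefficients but never differentiates afterwards, so at a fixed point such a
    coefficient is a number. Only prolongations are differentiated; their coefficients are
    polynomials and are kept as syntax, on which [Dx] and [Dy] compute. Reducing an equation of
    order 2 gives four linear relations between its six coefficients, which leaves [lam] and [mu]
    free. The complex analysis is needed because the comparison is made on a small open set, whereas
    the conclusion concerns all of [D]. Relations are proved on a disc and carried to [D] by the
    identity theorem. This works because the final equations of the curve contain no derivatives.
    Differentiability in Caratheodory's form reduces products and inverses to rules for continuous
    functions. Origin of [s]: a line with [u' = sqrt(kap) v'] has the form [sqrt(kap) v = u + s],
    and it is tangent to [u^2 + v^2 = 1] exactly when [s^2 = kap + 1]. Squaring gives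
    [1 - y = (u + s)^2 / (s^2 - 1)]. *)

Lemma is_pseries_C (a : nat -> C) (z l : C) :
  is_pseries a z l <-> is_series (fun n => a n * z ^ n) l.
Proof.
  assert (E : forall n, scal (pow_n z n) (a n) = a n * z ^ n).
  { intro n. change (z ^ n * a n = a n * z ^ n). apply Cmult_comm. }
  unfold is_pseries; split; apply is_series_ext; intro n; rewrite E; reflexivity.
Qed.

(** Balls of [C] come from the product structure and are squares. A square of half-side [d / sqrt 2]
    fits into the disc of radius [d], hence the factor [sqrt 2]. *)
Lemma open_disc (D : C -> Prop) :
  open D <-> forall z, D z -> exists d, (0 < d)%R /\ forall w, (Cmod (w - z) < d)%R -> D w.
Proof.
  split.
  - intros HD z Hz. destruct (HD z Hz) as [e He]. exists e; split; [apply cond_pos|].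
    intros w Hw. apply He, C_NormedModule_mixin_compat1, Hw.
  - intros H z Hz. destruct (H z Hz) as [d [Hd Hw]].
    assert (Hs : (0 < sqrt 2)%R) by (apply sqrt_lt_R0; lra).
    assert (He : (0 < d / sqrt 2)%R) by (apply Rdiv_lt_0_compat; lra).
    exists (mkposreal _ He). intros w Hb. apply Hw.
    apply C_NormedModule_mixin_compat2 in Hb. simpl in Hb.
    replace (sqrt 2 * (d / sqrt 2))%R with d in Hb by (field; lra). exact Hb.
Qed.

(** * Continuity and complex differentiability at a point *)

Definition ccont (f : C -> C) (z : C) : Prop :=
  forall e, (0 < e)%R -> exists d, (0 < d)%R /\
    forall w, (Cmod (w - z) < d)%R -> (Cmod (f w - f z) < e)%R.

(* Caratheodory's form of differentiability: the difference quotient extends continuously. *)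
Definition cdiff (f : C -> C) (z l : C) : Prop :=
  exists q, ccont q z /\ q z = l /\ exists d, (0 < d)%R /\
    forall w, (Cmod (w - z) < d)%R -> f w = f z + (w - z) * q w.

Lemma ccont_const (c z : C) : ccont (fun _ => c) z.
Proof. intros e He; exists 1%R; split; [lra|]. intros; replace (c - c) with (RtoC 0) by ring.
now rewrite Cmod_0. Qed.

Lemma ccont_id (z : C) : ccont (fun w => w) z.
Proof. intros e He; exists e; split; auto. Qed.

Lemma ccont_plus f g z : ccont f z -> ccont g z -> ccont (fun w => f w + g w) z.
Proof.
  intros Hf Hg e He.
  destruct (Hf (e/2)%R) as [d1 [H1 K1]]; [lra|]. destruct (Hg (e/2)%R) as [d2 [H2 K2]]; [lra|].
  exists (Rmin d1 d2); split; [now apply Rmin_pos|]. intros w Hw.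
  pose proof (Rmin_l d1 d2); pose proof (Rmin_r d1 d2).
  replace (f w + g w - (f z + g z)) with ((f w - f z) + (g w - g z)) by ring.
  eapply Rle_lt_trans; [apply Cmod_triangle|].
  specialize (K1 w ltac:(lra)); specialize (K2 w ltac:(lra)); lra.
Qed.

Lemma ccont_mult f g z : ccont f z -> ccont g z -> ccont (fun w => f w * g w) z.
Proof.
  intros Hf Hg e He. set (M := (Cmod (f z) + Cmod (g z) + 1)%R).
  pose proof (Cmod_ge_0 (f z)) as P1; pose proof (Cmod_ge_0 (g z)) as P2.
  assert (HM : (0 < M)%R) by (unfold M; lra).
  set (e' := Rmin 1 (e / (2 * M))).
  assert (He' : (0 < e')%R) by (apply Rmin_pos; [lra|apply Rdiv_lt_0_compat; lra]).
  assert (E1 : (e' <= 1)%R) by apply Rmin_l.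
  assert (E2 : (e' * M <= e / 2)%R).
  { apply Rle_trans with (e / (2 * M) * M)%R; [apply Rmult_le_compat_r; [lra|apply Rmin_r]|right; field;
      lra]. }
  destruct (Hf e' He') as [d1 [H1 K1]]. destruct (Hg e' He') as [d2 [H2 K2]].
  exists (Rmin d1 d2); split; [now apply Rmin_pos|]. intros w Hw.
  pose proof (Rmin_l d1 d2); pose proof (Rmin_r d1 d2).
  replace (f w * g w - f z * g z) with
    ((f w - f z) * (g w - g z) + ((f w - f z) * g z + f z * (g w - g z))) by ring.
  specialize (K1 w ltac:(lra)); specialize (K2 w ltac:(lra)).
  eapply Rle_lt_trans; [apply Cmod_triangle|].
  eapply Rle_lt_trans; [apply Rplus_le_compat_l, Cmod_triangle|].
  rewrite !Cmod_mult.
  pose proof (Cmod_ge_0 (f w - f z)); pose proof (Cmod_ge_0 (g w - g z)).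
  assert ((Cmod (f w - f z) * Cmod (g w - g z) <= e' * 1)%R) by (apply Rmult_le_compat; lra).
  assert ((Cmod (f w - f z) * Cmod (g z) <= e' * Cmod (g z))%R) by (apply Rmult_le_compat; lra).
  assert ((Cmod (f z) * Cmod (g w - g z) <= Cmod (f z) * e')%R) by (apply Rmult_le_compat; lra).
  unfold M in E2. nra.
Qed.

Lemma ccont_neq0 f z : ccont f z -> f z <> 0 ->
  exists d, (0 < d)%R /\ forall w, (Cmod (w - z) < d)%R -> (Cmod (f z) / 2 < Cmod (f w))%R.
Proof.
  intros Hf H0. apply Cmod_gt_0 in H0. destruct (Hf (Cmod (f z) / 2)%R) as [d [Hd K]]; [lra|].
  exists d; split; auto. intros w Hw. specialize (K w Hw).
  pose proof (Cmod_triangle (f w) (- (f w - f z))) as T. rewrite Cmod_opp in T.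
  replace (f w + - (f w - f z)) with (f z) in T by ring. lra.
Qed.

Lemma ccont_inv f z : ccont f z -> f z <> 0 -> ccont (fun w => / f w) z.
Proof.
  intros Hf H0 e He. destruct (ccont_neq0 f z Hf H0) as [d1 [H1 K1]].
  apply Cmod_gt_0 in H0 as H0'. set (m := Cmod (f z)) in *.
  destruct (Hf (e * (m * m) / 2)%R) as [d2 [H2 K2]];
    [apply Rdiv_lt_0_compat; [repeat apply Rmult_lt_0_compat; auto|lra]|].
  exists (Rmin d1 d2); split; [now apply Rmin_pos|]. intros w Hw.
  pose proof (Rmin_l d1 d2); pose proof (Rmin_r d1 d2).
  specialize (K1 w ltac:(lra)); specialize (K2 w ltac:(lra)).
  assert (Hw0 : f w <> 0) by (apply Cmod_gt_0; lra).
  replace (/ f w - / f z) with (- (f w - f z) / (f w * f z)) by (field; auto).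
  rewrite Cmod_div by (now apply Cmult_neq_0). rewrite Cmod_opp, Cmod_mult.
  fold m. apply Rmult_lt_reg_r with (Cmod (f w) * m)%R; [apply Rmult_lt_0_compat; lra|].
  unfold Rdiv. rewrite Rmult_assoc, Rinv_l, Rmult_1_r by (apply Rgt_not_eq; apply Rmult_lt_0_compat; lra).
  eapply Rlt_trans; [exact K2|].
  assert ((m / 2 * m < Cmod (f w) * m)%R) by (apply Rmult_lt_compat_r; lra).
  replace (e * (m * m) / 2)%R with (e * (m / 2 * m))%R by field. now apply Rmult_lt_compat_l.
Qed.

Lemma ccont_ext f g z : (exists d, (0 < d)%R /\ forall w, (Cmod (w - z) < d)%R -> f w = g w) ->
  ccont f z -> ccont g z.
Proof.
  intros [d [Hd E]] H e He. destruct (H e He) as [d' [Hd' K]].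
  exists (Rmin d d'); split; [now apply Rmin_pos|]. intros w Hw.
  pose proof (Rmin_l d d'); pose proof (Rmin_r d d').
  rewrite <- !E; [apply K; lra| |lra]. replace (z - z) with (RtoC 0) by ring. now rewrite Cmod_0.
Qed.

Lemma cdiff_ccont f z l : cdiff f z l -> ccont f z.
Proof.
  intros (q & Hq & _ & d & Hd & E).
  assert (H : ccont (fun w => f z + (w + - z) * q w) z)
    by (apply ccont_plus; [apply ccont_const|apply ccont_mult; auto; apply ccont_plus;
      [apply ccont_id|apply ccont_const]]).
  refine (ccont_ext _ _ _ _ H). exists d; split; auto. intros w Hw. symmetry. apply E, Hw.
Qed.

Lemma cdiff_const (c z : C) : cdiff (fun _ => c) z 0.
Proof.
  exists (fun _ => RtoC 0). repeat split; [apply ccont_const|]. exists 1%R; split; [lra|]. intros; ring.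
Qed.

Lemma cdiff_id (z : C) : cdiff (fun w => w) z 1.
Proof.
  exists (fun _ => RtoC 1). repeat split; [apply ccont_const|]. exists 1%R; split; [lra|]. intros; ring.
Qed.

Lemma cdiff_plus f g z l m : cdiff f z l -> cdiff g z m -> cdiff (fun w => f w + g w) z (l + m).
Proof.
  intros (q & Hq & <- & d & Hd & E) (p & Hp & <- & d' & Hd' & E').
  exists (fun w => q w + p w). split; [now apply ccont_plus|]. split; auto.
  exists (Rmin d d'); split; [now apply Rmin_pos|]. intros w Hw.
  pose proof (Rmin_l d d'); pose proof (Rmin_r d d').
  rewrite E, E' by lra. ring.
Qed.

Lemma cdiff_mult f g z l m : cdiff f z l -> cdiff g z m ->
  cdiff (fun w => f w * g w) z (l * g z + f z * m).
Proof.
  intros Hf Hg. pose proof (cdiff_ccont _ _ _ Hg) as Cg.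
  destruct Hf as (q & Hq & <- & d & Hd & E), Hg as (p & Hp & <- & d' & Hd' & E').
  exists (fun w => q w * g w + f z * p w).
  split; [apply ccont_plus; apply ccont_mult; auto using ccont_const|]. split; auto.
  exists (Rmin d d'); split; [now apply Rmin_pos|]. intros w Hw.
  pose proof (Rmin_l d d'); pose proof (Rmin_r d d').
  rewrite E by lra. rewrite (E' w) by lra. ring.
Qed.

Lemma cdiff_inv f z l : cdiff f z l -> f z <> 0 -> cdiff (fun w => / f w) z (- l * (/ f z * / f z)).
Proof.
  intros Hf H0. pose proof (cdiff_ccont _ _ _ Hf) as Cf.
  destruct Hf as (q & Hq & <- & d & Hd & E).
  destruct (ccont_neq0 f z Cf H0) as [d' [Hd' K]].
  exists (fun w => - (1) * q w * (/ f w * / f z)).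
  split; [repeat apply ccont_mult; auto using ccont_const, ccont_inv|]. split; [ring|].
  exists (Rmin d d'); split; [now apply Rmin_pos|]. intros w Hw.
  pose proof (Rmin_l d d'); pose proof (Rmin_r d d').
  specialize (K w ltac:(lra)). pose proof (Cmod_ge_0 (f z)).
  assert (Hw0 : f w <> 0) by (apply Cmod_gt_0; lra).
  assert (Eq : (w - z) * q w = f w - f z) by (rewrite (E w) by lra; ring).
  replace ((w - z) * (- (1) * q w * (/ f w * / f z))) with (- ((w - z) * q w) * (/ f w * / f z)) by ring.
  rewrite Eq. field; auto.
Qed.

Lemma cdiff_ext f g z l : (exists d, (0 < d)%R /\ forall w, (Cmod (w - z) < d)%R -> f w = g w) ->
  cdiff f z l -> cdiff g z l.
Proof.
  intros [d [Hd E]] (q & Hq & Hl & d' & Hd' & K). exists q; repeat split; auto.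
  exists (Rmin d d'); split; [now apply Rmin_pos|]. intros w Hw.
  pose proof (Rmin_l d d'); pose proof (Rmin_r d d').
  rewrite <- !E; [apply K; lra| |lra]. replace (z - z) with (RtoC 0) by ring. now rewrite Cmod_0.
Qed.

Lemma cdiff_C_derive f z l : cdiff f z l -> C_derive f z = l.
Proof.
  intros (q & Hq & Hl & d & Hd & E). apply is_C_derive_unique. split; [apply is_linear_scal_l|].
  intros x Hx. apply (@is_filter_lim_locally_unique C_AbsRing (AbsRing_NormedModule C_AbsRing)) in Hx.
  simpl in Hx; subst x. intros e.
  destruct (Hq e (cond_pos e)) as [d' [Hd' K]].
  exists (mkposreal _ (Rmin_pos _ _ Hd Hd')). intros w Hw.
  pose proof (Rmin_l d d'); pose proof (Rmin_r d d').
  assert (Hw' : (Cmod (w - z) < Rmin d d')%R) by exact Hw.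
  change (Cmod (f w - f z - (w - z) * l) <= e * Cmod (w - z))%R.
  rewrite E by lra. replace (f z + (w - z) * q w - f z - (w - z) * l) with ((q w - q z) * (w - z)) by
    (rewrite Hl; ring).
  rewrite Cmod_mult. apply Rmult_le_compat_r; [apply Cmod_ge_0|]. left. apply K. lra.
Qed.

(** The difference quotient, given the value [l] at [z], differs from [l] by at most [M |w - z|], so
    it is continuous at [z]. This is the form in which Taylor remainders of power series are
    used. *)
Lemma cdiff_of_bound f z l M d : (0 < d)%R ->
  (forall w, (Cmod (w - z) < d)%R ->
     (Cmod (f w - f z - l * (w - z)) <= M * (Cmod (w - z) * Cmod (w - z)))%R) ->
  cdiff f z l.
Proof.
  intros Hd H.
  set (q := fun w => if excluded_middle_informative (w = z) then l else (f w - f z) / (w - z)).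
  exists q. assert (Hqz : q z = l) by (unfold q; destruct excluded_middle_informative; congruence).
  split; [|split; auto].
  - intros e He. set (M' := (Rabs M + 1)%R). assert (HM : (0 < M')%R) by (unfold M';
      pose proof (Rabs_pos M); lra).
    exists (Rmin d (e / M')); split; [apply Rmin_pos; auto; apply Rdiv_lt_0_compat; auto|].
    intros w Hw. pose proof (Rmin_l d (e / M')); pose proof (Rmin_r d (e / M')).
    rewrite Hqz. unfold q. destruct excluded_middle_informative as [->|Hne].
    { replace (l - l) with (RtoC 0) by ring. now rewrite Cmod_0. }
    assert (Hne' : w - z <> 0) by (intro Q; apply Hne; replace w with (w - z + z) by ring; rewrite Q; ring).
    replace ((f w - f z) / (w - z) - l) with ((f w - f z - l * (w - z)) / (w - z)) by (field; auto).
    rewrite Cmod_div by auto. apply Cmod_gt_0 in Hne'.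
    apply Rle_lt_trans with (M' * Cmod (w - z))%R.
    + apply Rmult_le_reg_r with (Cmod (w - z)); auto. unfold Rdiv.
      rewrite Rmult_assoc, Rinv_l, Rmult_1_r by lra.
      eapply Rle_trans; [apply H; lra|]. rewrite <- Rmult_assoc. apply Rmult_le_compat_r; [lra|].
      apply Rmult_le_compat_r; [lra|]. unfold M'. pose proof (Rle_abs M). lra.
    + replace e with (M' * (e / M'))%R by (field; lra). apply Rmult_lt_compat_l; lra.
  - exists d; split; auto. intros w Hw. unfold q. destruct excluded_middle_informative as [->|Hne]; [ring|].
    field. intro Q; apply Hne; replace w with (w - z + z) by ring; rewrite Q; ring.
Qed.

(** * Termwise differentiation of power series *)

Lemma is_series_Cmod_le (u : nat -> C) (v : nat -> R) (l : C) (s : R) :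
  is_series u l -> is_series v s -> (forall n, (Cmod (u n) <= v n)%R) -> (Cmod l <= s)%R.
Proof.
  intros Hu Hv H.
  assert (L : is_lim_seq (fun n => Cmod (sum_n u n)) (Cmod l)).
  { apply (filterlim_comp _ _ _ (sum_n u) (@norm C_AbsRing C_NormedModule) eventually (locally l)).
    - exact Hu.
    - apply (@filterlim_norm C_AbsRing C_NormedModule). }
  refine (is_lim_seq_le _ (sum_n v) (Cmod l) s _ L Hv).
  intro n. induction n as [|n IH]; [rewrite !sum_O; apply H|].
  rewrite !sum_Sn. eapply Rle_trans; [apply Cmod_triangle|]. apply Rplus_le_compat; [exact IH|apply H].
Qed.

(** Convergence at one point [r'] between [rho] and [r] bounds the partial sums by some [M], hence
    each term, a difference of two partial sums, by [2 M]. This opens the theory of real power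
    series to the moduli of the coefficients. *)
Lemma pseries_CV_radius (a : nat -> C) (r : R) :
  (forall h, (Cmod h < r)%R -> exists l, is_series (fun n => a n * h ^ n) l) ->
  forall rho, (0 <= rho < r)%R -> Rbar_lt rho (CV_radius (fun n => Cmod (a n))).
Proof.
  intros H rho Hr. set (r' := ((rho + r) / 2)%R).
  assert (Hr' : (0 < r' < r)%R) by (unfold r'; lra).
  apply Rbar_lt_le_trans with r'; [simpl; unfold r'; lra|].
  apply (proj1 (CV_radius_bounded _)).
  destruct (H (RtoC r')) as [l Hl]; [rewrite Cmod_R, Rabs_pos_eq; lra|].
  destruct (@filterlim_bounded C_AbsRing C_NormedModule _ (ex_intro _ l Hl)) as [M HM].
  exists (2 * M)%R. intro n.
  assert (E : (Rabs (Cmod (a n) * r' ^ n) = Cmod (a n * RtoC r' ^ n))%R).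
  { rewrite Cmod_mult, Cmod_pow, Cmod_R, (Rabs_pos_eq r') by lra.
    apply Rabs_pos_eq, Rmult_le_pos; [apply Cmod_ge_0|apply pow_le; lra]. }
  rewrite E. destruct n as [|n].
  - specialize (HM 0%nat). rewrite sum_O in HM. pose proof (Cmod_ge_0 (a 0%nat * RtoC r' ^ 0)).
    change (Cmod (a 0%nat * RtoC r' ^ 0) <= M)%R in HM. lra.
  - pose proof (HM n) as H1. pose proof (HM (S n)) as H2. rewrite sum_Sn in H2.
    set (t := a (S n) * RtoC r' ^ S n) in *.
    match type of H1 with context [sum_n ?u n] => set (p := sum_n u n : C) in * end.
    change (Cmod (p + t)%C <= M)%R in H2. change (Cmod p <= M)%R in H1.
    pose proof (Cmod_triangle (p + t) (- p)) as T. rewrite Cmod_opp in T.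
    replace (p + t + - p) with t in T by ring. lra.
Qed.

(** Second order Taylor remainder of a power. The constant is chosen so that, weighted by the moduli
    of the coefficients, the bounds add up to the twice differentiated series of moduli at [rho]. In
    the induction, the remainder for the next exponent is [W] times the previous one plus a multiple
    of [H * H]. *)
Lemma pow_remainder (W Z : C) (rho : R) (n : nat) : (Cmod W <= rho)%R -> (Cmod Z <= rho)%R ->
  (Cmod (W ^ S (S n) - Z ^ S (S n) - RtoC (INR (S (S n))) * Z ^ S n * (W - Z))
   <= INR (S n) * INR (S (S n)) * rho ^ n * (Cmod (W - Z) * Cmod (W - Z)))%R.
Proof.
  intros HW HZ. set (H := W - Z). assert (EW : W = Z + H) by (unfold H; ring).
  pose proof (Cmod_ge_0 W) as P1; pose proof (Cmod_ge_0 Z) as P2; pose proof (Cmod_ge_0 H) as P3.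
  assert (P4 : (0 <= rho)%R) by lra.
  induction n as [|n IH].
  - replace (W ^ 2 - Z ^ 2 - RtoC (INR 2) * Z ^ 1 * H) with (H * H).
    + rewrite Cmod_mult. simpl. nra.
    + rewrite EW. replace (INR 2) with 2%R by (simpl; lra). ring.
  - replace (W ^ S (S (S n)) - Z ^ S (S (S n)) - RtoC (INR (S (S (S n)))) * Z ^ S (S n) * H)
      with (W * (W ^ S (S n) - Z ^ S (S n) - RtoC (INR (S (S n))) * Z ^ S n * H)
            + RtoC (INR (S (S n))) * Z ^ S n * (H * H)).
    2:{ rewrite (S_INR (S (S n))), RtoC_plus. rewrite !(Cpow_S W), !(Cpow_S Z). rewrite EW. ring. }
    eapply Rle_trans; [apply Cmod_triangle|]. rewrite !Cmod_mult, Cmod_pow, Cmod_R.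
    set (N := INR (S (S n))) in *. assert (HN : (0 <= N)%R) by apply pos_INR.
    rewrite (Rabs_pos_eq N HN). set (E := Cmod (W ^ S (S n) - Z ^ S (S n) - RtoC N * Z ^ S n * H)) in *.
    assert (Q : (0 <= rho ^ n)%R) by now apply pow_le.
    assert (A1 : (Cmod W * E <= rho * (INR (S n) * N * rho ^ n * (Cmod H * Cmod H)))%R)
      by (apply Rmult_le_compat; auto; apply Cmod_ge_0).
    assert (A2 : (Cmod Z ^ S n <= rho ^ S n)%R) by (apply pow_incr; lra).
    assert (A3 : (N * Cmod Z ^ S n * (Cmod H * Cmod H) <= N * rho ^ S n * (Cmod H * Cmod H))%R).
    { apply Rmult_le_compat_r; [nra|]. now apply Rmult_le_compat_l. }
    eapply Rle_trans; [apply Rplus_le_compat; [exact A1|exact A3]|].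
    rewrite (S_INR (S (S n))). fold N.
    assert (EN : N = (INR (S n) + 1)%R) by (unfold N; apply S_INR).
    assert (Q' : (0 <= N * rho ^ S n * (Cmod H * Cmod H))%R)
      by (apply Rmult_le_pos; [apply Rmult_le_pos; auto; now apply pow_le|nra]).
    replace (rho ^ S n)%R with (rho * rho ^ n)%R in * by reflexivity.
    replace (INR (S n)) with (N - 1)%R by lra. nra.
Qed.

Definition C_PS_derive (a : nat -> C) (n : nat) : C := RtoC (INR (S n)) * a (S n).

(** The remainder [f w - f z - l (w - z)] is bounded term by term through [pow_remainder]. The
    bounds sum to [s2] times [|w - z|^2], where [s2] is finite because [rho < r], and
    [cdiff_of_bound] applies. *)
Lemma pseries_cdiff (f : C -> C) (z0 : C) (a : nat -> C) (r : R) :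
  (forall z, (Cmod (z - z0) < r)%R -> is_series (fun n => a n * (z - z0) ^ n) (f z)) ->
  forall z, (Cmod (z - z0) < r)%R ->
    exists l, is_series (fun n => C_PS_derive a n * (z - z0) ^ n) l /\ cdiff f z l.
Proof.
  intros Hf z Hz. set (Z := z - z0) in *. set (rho := ((Cmod Z + r) / 2)%R).
  pose proof (Cmod_ge_0 Z) as PZ. assert (Hrho : (Cmod Z < rho < r)%R) by (unfold rho; lra).
  set (A := fun n => Cmod (a n)).
  assert (HA : Rbar_lt (Rabs rho) (CV_radius A)).
  { rewrite Rabs_pos_eq by lra. apply (pseries_CV_radius a r); [|lra].
    intros h Hh. exists (f (z0 + h)). specialize (Hf (z0 + h)).
    replace (z0 + h - z0) with h in Hf by ring. auto. }
  assert (H1 := HA). rewrite <- CV_radius_derive in H1. apply CV_disk_inside in H1.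
  assert (H2 := HA). rewrite <- CV_radius_derive, <- CV_radius_derive in H2. apply CV_disk_inside in H2.
  assert (L : ex_series (fun n => C_PS_derive a n * Z ^ n)).
  { apply (@ex_series_le C_AbsRing C_CompleteNormedModule) with (2 := H1). intro n.
    change (Cmod (C_PS_derive a n * Z ^ n) <= Rabs (PS_derive A n * rho ^ n))%R.
    unfold C_PS_derive, PS_derive, A. rewrite !Cmod_mult, Cmod_pow, Cmod_R, !Rabs_mult.
    rewrite (Rabs_pos_eq (Cmod _)) by apply Cmod_ge_0.
    apply Rmult_le_compat_l; [apply Rmult_le_pos; [apply Rabs_pos|apply Cmod_ge_0]|].
    eapply Rle_trans; [|apply Rle_abs]. apply pow_incr; lra. }
  destruct L as [l Hl]. exists l. split; [exact Hl|]. destruct H2 as [s2 Hs2].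
  apply (cdiff_of_bound _ _ _ s2 (rho - Cmod Z)); [lra|]. intros w Hw.
  set (W := w - z0). assert (EH : w - z = W - Z) by (unfold W, Z; ring).
  assert (HW : (Cmod W < rho)%R).
  { pose proof (Cmod_triangle Z (w - z)) as T. replace (Z + (w - z)) with W in T by (unfold W, Z; ring).
    lra. }
  (* The derived series, shifted by one place so that its terms line up with those of [f]. *)
  set (c := fun n => match n with O => RtoC 0 | S k => C_PS_derive a k * Z ^ k end).
  assert (Hc : is_series c l).
  { apply (@is_series_decr_1 C_AbsRing C_NormedModule).
    assert (E : @plus C_AbelianMonoid l (opp (c 0%nat : C)) = l) by (change (l + - (0) = l); ring).
    match goal with |- is_series _ ?x => replace x with l by (symmetry; exact E) end. exact Hl. }
  (* Majorant of the remainder terms; the first two are 0 because constants and linear functions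
     have no second order remainder. *)
  set (v := fun n => match n with S (S k) => (Cmod (w - z) * Cmod (w - z) * Rabs (PS_derive (PS_derive
    A) k * rho ^ k))%R | _ => 0%R end).
  assert (Hv : is_series v (Cmod (w - z) * Cmod (w - z) * s2)%R).
  { apply is_series_decr_1, is_series_decr_1. simpl.
    replace (plus (plus _ _) _) with (Cmod (w - z) * Cmod (w - z) * s2)%R.
    - apply (is_series_scal_l (Cmod (w - z) * Cmod (w - z))%R _ _ Hs2).
    - unfold plus, opp; simpl. ring. }
  rewrite (Rmult_comm s2).
  refine (is_series_Cmod_le
    (fun n => plus (plus (a n * W ^ n) (opp (a n * Z ^ n))) (opp (scal (w - z) (c n)))) v _ _ _ Hv _).
  - replace (f w - f z - l * (w - z)) with (plus (plus (f w) (opp (f z))) (opp (scal (w - z) l)) : C).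
    2:{ change (f w + - f z + - ((w - z) * l) = f w - f z - l * (w - z)). ring. }
    apply (@is_series_plus C_AbsRing C_NormedModule); [apply (@is_series_plus C_AbsRing C_NormedModule)|].
    + apply Hf. fold W. lra.
    + apply (@is_series_opp C_AbsRing C_NormedModule). apply Hf. exact Hz.
    + apply (@is_series_opp C_AbsRing C_NormedModule).
      apply (@is_series_scal C_AbsRing C_NormedModule). exact Hc.
  - intro n. change (Cmod (a n * W ^ n + - (a n * Z ^ n) + - ((w - z) * c n)) <= v n)%R. rewrite EH.
    destruct n as [|[|n]]; simpl c; simpl v.
    + replace (_ + _) with (RtoC 0); [rewrite Cmod_0; lra|]. simpl. ring.
    + replace (_ + _) with (RtoC 0); [rewrite Cmod_0; lra|].
      unfold C_PS_derive. simpl. ring.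
    + unfold C_PS_derive.
      match goal with |- (Cmod ?X <= _)%R =>
        replace X with (a (S (S n)) * (W ^ S (S n) - Z ^ S (S n) - RtoC (INR (S (S n))) * Z ^ S n * (W - Z)))
      end.
      2:{ change (a (S (S n)) * (W ^ S (S n) - Z ^ S (S n) - RtoC (INR (S (S n))) * Z ^ S n * (W - Z)) =
          a (S (S n)) * W ^ S (S n) + - (a (S (S n)) * Z ^ S (S n)) +
          - ((W - Z) * (RtoC (INR (S (S n))) * a (S (S n)) * Z ^ S n))). ring. }
      rewrite Cmod_mult. eapply Rle_trans; [apply Rmult_le_compat_l; [apply Cmod_ge_0|]|].
      { apply (pow_remainder W Z rho n); lra. }
      rewrite EH. unfold PS_derive, A. right.
      rewrite (Rabs_pos_eq (_ * _)).
      2:{ apply Rmult_le_pos; [|apply pow_le; lra].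
          apply Rmult_le_pos; [apply pos_INR|apply Rmult_le_pos; [apply pos_INR|apply Cmod_ge_0]]. }
      ring.
Qed.

(** Restores [C] as the type of an equation left at the carrier of a Coquelicot structure, where
    [ring] does not recognize it. *)
Ltac Cring := match goal with |- @eq _ ?x ?y => change (@eq C x y) end; ring.

(** * Sums, products and derivatives of analytic functions *)

Definition analytic_at (f : C -> C) (z0 : C) : Prop :=
  exists (a : nat -> C) (r : R), (0 < r)%R /\
    forall z, (Cmod (z - z0) < r)%R -> is_series (fun n => a n * (z - z0) ^ n) (f z).

Lemma holomorphic_analytic (D : C -> Prop) (f : C -> C) :
  holomorphic D f <-> forall z, D z -> analytic_at f z.
Proof.
  split; intros H z Hz.
  - destruct (H z Hz) as (a & r & K). exists a, r. split; [apply cond_pos|].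
    intros w Hw. apply is_pseries_C, K, Hw.
  - destruct (H z Hz) as (a & r & Hr & K). exists a, (mkposreal r Hr).
    intros w Hw. apply is_pseries_C, K, Hw.
Qed.

(** The derived series is valid on the same disc, since [pseries_cdiff] applies at each of its
    points and not only at the centre. *)
Lemma analytic_at_C_derive f z : analytic_at f z -> analytic_at (C_derive f) z.
Proof.
  intros (a & r & Hr & K). exists (C_PS_derive a), r. split; auto. intros w Hw.
  destruct (pseries_cdiff f z a r K w Hw) as [l [Hl Hd]]. now rewrite (cdiff_C_derive _ _ _ Hd).
Qed.

Lemma Cmod_sub_diag (z : C) : Cmod (z - z) = 0%R.
Proof. replace (z - z) with (RtoC 0) by ring. apply Cmod_0. Qed.

Lemma analytic_at_cdiff f z : analytic_at f z -> cdiff f z (C_derive f z).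
Proof.
  intros (a & r & Hr & K). destruct (pseries_cdiff f z a r K z) as [l [_ Hd]].
  { now rewrite Cmod_sub_diag. }
  now rewrite (cdiff_C_derive _ _ _ Hd).
Qed.

Lemma is_series_single (m : nat) (c : C) : is_series (fun n => if Nat.eqb n m then c else RtoC 0) c.
Proof.
  assert (E : forall n, sum_n (fun n => if Nat.eqb n m then c else RtoC 0) n = if Nat.leb m n then c
    else RtoC 0).
  { induction n as [|n IH]; [rewrite sum_O; now destruct m|].
    rewrite sum_Sn, IH. change (@plus _) with Cplus.
    destruct (Nat.eqb_spec (S n) m), (Nat.leb_spec m n), (Nat.leb_spec m (S n)); try lia; Cring. }
  apply (filterlim_ext_loc (fun _ : nat => c)).
  - exists m. intros n Hn. rewrite E. destruct (Nat.leb_spec m n); [auto|lia].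
  - apply filterlim_const.
Qed.

Lemma analytic_at_const (c z : C) : analytic_at (fun _ => c) z.
Proof.
  exists (fun n => if Nat.eqb n 0 then c else RtoC 0), 1%R. split; [lra|]. intros w _.
  refine (is_series_ext _ _ _ _ (is_series_single 0 c)). intro n.
  destruct n; simpl; Cring.
Qed.

Lemma analytic_at_plus f g z : analytic_at f z -> analytic_at g z -> analytic_at (fun w => f w + g w) z.
Proof.
  intros (a & r & Hr & K) (b & r' & Hr' & K'). exists (fun n => a n + b n), (Rmin r r').
  split; [now apply Rmin_pos|]. intros w Hw.
  pose proof (Rmin_l r r'); pose proof (Rmin_r r r').
  refine (is_series_ext _ _ _ _ (@is_series_plus C_AbsRing C_NormedModule _ _ _ _ (K w ltac:(lra)) (K' w
    ltac:(lra)))).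
  intro n. change (a n * (w - z) ^ n + b n * (w - z) ^ n = (a n + b n) * (w - z) ^ n). ring.
Qed.

Lemma is_series_C (u : nat -> C) (l : C) :
  is_series u l <-> is_series (fun n => fst (u n)) (fst l) /\ is_series (fun n => snd (u n)) (snd l).
Proof.
  assert (E1 : forall n, fst (sum_n u n) = sum_n (fun n => fst (u n)) n).
  { induction n as [|n IH]; [now rewrite !sum_O|]. rewrite !sum_Sn, <- IH. reflexivity. }
  assert (E2 : forall n, snd (sum_n u n) = sum_n (fun n => snd (u n)) n).
  { induction n as [|n IH]; [now rewrite !sum_O|]. rewrite !sum_Sn, <- IH. reflexivity. }
  split.
  - intro H. pose proof (proj1 (filterlim_locally _ _) H) as H'.
    split; apply filterlim_locally; intro e; destruct (H' e) as [N HN]; exists N; intros n Hn;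
      destruct (HN n Hn) as [B1 B2]; [rewrite <- E1|rewrite <- E2]; assumption.
  - intros [H1 H2]. apply filterlim_locally. intro e.
    destruct (proj1 (filterlim_locally _ _) H1 e) as [N1 K1].
    destruct (proj1 (filterlim_locally _ _) H2 e) as [N2 K2].
    exists (N1 + N2)%nat. intros n Hn. split; [rewrite E1; apply K1|rewrite E2; apply K2]; lia.
Qed.

Definition C_conv (u v : nat -> C) (n : nat) : C := sum_n (fun k => u k * v (n - k)%nat) n.

Lemma C_conv_fst u v n : fst (C_conv u v n) =
  (sum_f_R0 (fun k => fst (u k) * fst (v (n - k)%nat))%R n - sum_f_R0 (fun k => snd (u k) * snd (v (n -
    k)%nat))%R n)%R.
Proof.
  assert (E : forall (w : nat -> C) n, fst (sum_n (fun k => u k * w k) n) = (sum_f_R0 (fun k => fst (u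
    k) * fst (w k))%R n - sum_f_R0 (fun k => snd (u k) * snd (w k))%R n)%R).
  { intros w m. induction m as [|m IH]; [rewrite sum_O; reflexivity|].
    rewrite sum_Sn. simpl sum_f_R0. change (fst (plus ?x ?y)) with (fst x + fst y)%R.
    rewrite IH. simpl. ring. }
  exact (E (fun k => v (n - k)%nat) n).
Qed.

Lemma C_conv_snd u v n : snd (C_conv u v n) =
  (sum_f_R0 (fun k => fst (u k) * snd (v (n - k)%nat))%R n + sum_f_R0 (fun k => snd (u k) * fst (v (n -
    k)%nat))%R n)%R.
Proof.
  assert (E : forall (w : nat -> C) n, snd (sum_n (fun k => u k * w k) n) = (sum_f_R0 (fun k => fst (u
    k) * snd (w k))%R n + sum_f_R0 (fun k => snd (u k) * fst (w k))%R n)%R).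
  { intros w m. induction m as [|m IH]; [rewrite sum_O; reflexivity|].
    rewrite sum_Sn. simpl sum_f_R0. change (snd (plus ?x ?y)) with (snd x + snd y)%R.
    rewrite IH. simpl. ring. }
  exact (E (fun k => v (n - k)%nat) n).
Qed.

(** Real and imaginary parts split the product into four real Cauchy products. Each converges
    absolutely, since the parts are bounded by the modulus. *)
Lemma is_series_C_conv u v (l m : C) : is_series u l -> is_series v m ->
  ex_series (fun n => Cmod (u n)) -> ex_series (fun n => Cmod (v n)) ->
  is_series (C_conv u v) (l * m).
Proof.
  intros Hu Hv Au Av. apply is_series_C in Hu as [Hu1 Hu2]. apply is_series_C in Hv as [Hv1 Hv2].
  assert (F : forall w : nat -> C, ex_series (fun n => Cmod (w n)) -> ex_series (fun n => Rabs (fst (w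
    n))) /\ ex_series (fun n => Rabs (snd (w n)))).
  { intros w Aw. split; refine (@ex_series_le R_AbsRing R_CompleteNormedModule _ _ _ Aw); intro n;
      change (Rabs (Rabs ?x)) with (norm (norm x)); unfold norm; simpl; unfold abs; simpl;
      rewrite Rabs_Rabsolu; eapply Rle_trans; [|apply Rmax_Cmod| |apply Rmax_Cmod];
        [apply Rmax_l|apply Rmax_r]. }
  destruct (F u Au) as [Au1 Au2], (F v Av) as [Av1 Av2].
  apply is_series_C. split.
  - refine (is_series_ext _ _ _ (fun n => eq_sym (C_conv_fst u v n)) _).
    exact (is_series_minus _ _ _ _ (is_series_mult _ _ _ _ Hu1 Hv1 Au1 Av1) (is_series_mult _ _ _ _ Hu2
      Hv2 Au2 Av2)).
  - refine (is_series_ext _ _ _ (fun n => eq_sym (C_conv_snd u v n)) _).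
    exact (is_series_plus _ _ _ _ (is_series_mult _ _ _ _ Hu1 Hv2 Au1 Av2) (is_series_mult _ _ _ _ Hu2
      Hv1 Au2 Av1)).
Qed.

Lemma C_conv_pow (a b : nat -> C) (h : C) (n : nat) :
  C_conv (fun n => a n * h ^ n) (fun n => b n * h ^ n) n = C_conv a b n * h ^ n.
Proof.
  unfold C_conv.
  rewrite (sum_n_ext_loc _ (fun k => scal (h ^ n) (a k * b (n - k)%nat))).
  - rewrite (@sum_n_scal_l C_Ring C_ModuleSpace). change (@scal _ _) with Cmult. apply Cmult_comm.
  - intros k Hk. change (a k * h ^ k * (b (n - k)%nat * h ^ (n - k)) = h ^ n * (a k * b (n - k)%nat)).
    replace (h ^ n) with (h ^ k * h ^ (n - k)) by (rewrite <- Cpow_add_r; f_equal; lia). ring.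
Qed.

Lemma pseries_ex_series_Cmod (f : C -> C) (z : C) (a : nat -> C) (r : R) :
  (forall w, (Cmod (w - z) < r)%R -> is_series (fun n => a n * (w - z) ^ n) (f w)) ->
  forall w, (Cmod (w - z) < r)%R -> ex_series (fun n => Cmod (a n * (w - z) ^ n)).
Proof.
  intros K w Hw.
  assert (Q : Rbar_lt (Rabs (Cmod (w - z))) (CV_radius (fun n => Cmod (a n)))).
  { rewrite Rabs_pos_eq by apply Cmod_ge_0. apply (pseries_CV_radius a r); [|split; [apply Cmod_ge_0|auto]].
    intros h Hh. exists (f (z + h)). specialize (K (z + h)).
    replace (z + h - z) with h in K by ring. auto. }
  apply CV_disk_inside in Q. refine (ex_series_ext _ _ _ Q). intro n.
  rewrite Cmod_mult, Cmod_pow. apply Rabs_pos_eq, Rmult_le_pos; [|apply pow_le]; apply Cmod_ge_0.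
Qed.

Lemma analytic_at_mult f g z : analytic_at f z -> analytic_at g z -> analytic_at (fun w => f w * g w) z.
Proof.
  intros (a & r & Hr & K) (b & r' & Hr' & K'). exists (C_conv a b), (Rmin r r').
  split; [now apply Rmin_pos|]. intros w Hw.
  pose proof (Rmin_l r r'); pose proof (Rmin_r r r').
  refine (is_series_ext _ _ _ (C_conv_pow a b (w - z)) _).
  apply is_series_C_conv; [apply K; lra|apply K'; lra| |].
  - apply (pseries_ex_series_Cmod f z a r); auto; lra.
  - apply (pseries_ex_series_Cmod g z b r'); auto; lra.
Qed.

(** * Isolated zeros, the identity theorem, and functions with zero derivative *)

(** Let [m] be the least index of a nonzero coefficient and [k = |w - z|]. The terms beyond [m] are
    at most [(k / rho)^(m+1)] times those of the convergent series with sum [T]. A zero at [w] would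
    therefore force [|a m| rho^(m+1) <= k T], which fails for small [k > 0]. If no such [m] exists,
    the sum is 0 on the whole disc. *)
Lemma analytic_at_zero_isolated f z : analytic_at f z ->
  (exists d, (0 < d)%R /\ forall w, (Cmod (w - z) < d)%R -> f w = 0) \/
  (exists d, (0 < d)%R /\ forall w, (0 < Cmod (w - z) < d)%R -> f w <> 0).
Proof.
  intros (a & r & Hr & K). set (rho := (r / 2)%R). assert (Hrho : (0 < rho < r)%R) by (unfold rho; lra).
  assert (Er : Cmod (z + RtoC rho - z) = rho).
  { replace (z + RtoC rho - z) with (RtoC rho) by ring. rewrite Cmod_R. apply Rabs_pos_eq; lra. }
  assert (T : ex_series (fun n => Cmod (a n * (z + RtoC rho - z) ^ n))).
  { apply (pseries_ex_series_Cmod f z a r); auto. lra. }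
  destruct T as [T HT].
  assert (HT' : is_series (fun n => (Cmod (a n) * rho ^ n)%R) T).
  { refine (is_series_ext _ _ _ _ HT). intro n. now rewrite Cmod_mult, Cmod_pow, Er. }
  clear HT.
  assert (HT0 : (0 <= T)%R).
  { rewrite <- Cmod_0. refine (is_series_Cmod_le (fun n => if Nat.eqb n 0 then RtoC 0 else RtoC 0) _ _ _
      (is_series_single 0 0) HT' _).
    intro n. destruct (Nat.eqb n 0); rewrite Cmod_0; (apply Rmult_le_pos; [apply Cmod_ge_0|apply pow_le;
      lra]). }
  destruct (classic (exists m, a m <> 0)) as [[m0 Hm0]|H0].
  - right.
    destruct (Wf_nat.dec_inh_nat_subset_has_unique_least_element (fun m => a m <> 0)) as (m & (Hm &
      Hleast) & _).
    { intro n. apply classic. }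
    { now exists m0. }
    assert (Hlow : forall n, (n < m)%nat -> a n = 0).
    { intros n Hn. destruct (classic (a n = 0)) as [|Q]; auto. specialize (Hleast n Q). lia. }
    apply Cmod_gt_0 in Hm as Pm.
    assert (Prm : (0 < rho ^ S m)%R) by (apply pow_lt; lra).
    (* Below this radius [k (T + 1) < |a m| rho^(m+1)]; dividing by [T + 1] avoids having to show
       [T > 0]. *)
    exists (Rmin rho (Cmod (a m) * rho ^ S m / (T + 1))). split.
    { apply Rmin_pos; [lra|]. apply Rdiv_lt_0_compat; [|lra]. now apply Rmult_lt_0_compat. }
    intros w [Hw0 Hw] Hf.
    pose proof (Rmin_l rho (Cmod (a m) * rho ^ S m / (T + 1))) as M1;
    pose proof (Rmin_r rho (Cmod (a m) * rho ^ S m / (T + 1))) as M2.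
    set (h := w - z) in *. set (k := Cmod h) in *.
    assert (B : (Cmod (f w + - (a m * h ^ m)) <= (k / rho) ^ S m * T)%R).
    { refine (is_series_Cmod_le _ _ _ _ (@is_series_minus C_AbsRing C_NormedModule _ _ _ _ (K w
        ltac:(fold h k; lra)) (is_series_single m (a m * h ^ m))) (is_series_scal_l ((k / rho) ^ S m)%R
          _ _ HT') _).
      intro n. fold h. change (Cmod (a n * h ^ n + - (if Nat.eqb n m then a m * h ^ m else 0)) <= (k /
        rho) ^ S m * (Cmod (a n) * rho ^ n))%R.
      assert (Pos : (0 <= (k / rho) ^ S m * (Cmod (a n) * rho ^ n))%R).
      { apply Rmult_le_pos; [apply pow_le; apply Rdiv_le_0_compat; lra|].
        apply Rmult_le_pos; [apply Cmod_ge_0|apply pow_le; lra]. }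
      destruct (Nat.eqb_spec n m) as [->|Hne].
      { replace (_ + _) with (RtoC 0) by ring. now rewrite Cmod_0. }
      destruct (Nat.lt_ge_cases n m) as [Hlt|Hge].
      { eapply Rle_trans; [|exact Pos]. rewrite (Hlow n Hlt). replace (_ + _) with (RtoC 0) by ring.
        rewrite Cmod_0. lra. }
      replace (_ + _) with (a n * h ^ n) by ring. rewrite Cmod_mult, Cmod_pow. fold k.
      rewrite <- Rmult_assoc, (Rmult_comm _ (Cmod (a n))), Rmult_assoc.
      apply Rmult_le_compat_l; [apply Cmod_ge_0|].
      replace n with (S m + (n - S m))%nat by lia. rewrite !pow_add. unfold Rdiv. rewrite Rpow_mult_distr.
      replace (k ^ S m * (/ rho) ^ S m * (rho ^ S m * rho ^ (n - S m)))%R with (k ^ S m * rho ^ (n - S m))%R.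
      2:{ rewrite pow_inv. field. lra. }
      apply Rmult_le_compat_l; [apply pow_le; lra|]. apply pow_incr; lra. }
    rewrite Hf in B. replace (0 + - (a m * h ^ m)) with (- (a m * h ^ m)) in B by ring.
    rewrite Cmod_opp, Cmod_mult, Cmod_pow in B. fold k in B.
    assert (Pk : (0 < k ^ m)%R) by (apply pow_lt; lra).
    unfold Rdiv in B. rewrite Rpow_mult_distr, pow_inv in B. simpl (k ^ S m)%R in B.
    assert (B' : (Cmod (a m) * rho ^ S m <= k * T)%R).
    { apply Rmult_le_reg_r with (k ^ m)%R; auto.
      apply Rmult_le_reg_r with (/ rho ^ S m)%R; [now apply Rinv_0_lt_compat|].
      replace (Cmod (a m) * rho ^ S m * k ^ m * / rho ^ S m)%R with (Cmod (a m) * k ^ m)%R by (field; lra).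
      replace (k * T * k ^ m * / rho ^ S m)%R with (k * k ^ m * / rho ^ S m * T)%R by ring. exact B. }
    assert (k * (T + 1) < Cmod (a m) * rho ^ S m)%R.
    { replace (Cmod (a m) * rho ^ S m)%R with (Cmod (a m) * rho ^ S m / (T + 1) * (T + 1))%R by (field; lra).
      apply Rmult_lt_compat_r; lra. }
    lra.
  - left. exists r; split; auto. intros w Hw. apply Cmod_eq_0. apply Rle_antisym; [|apply Cmod_ge_0].
    replace 0%R with (0 * T)%R by ring.
    refine (is_series_Cmod_le _ _ _ _ (K w Hw) (is_series_scal_l 0%R _ _ HT') _).
    intro n. assert (E : a n = 0) by (apply NNPP; intro Q; apply H0; now exists n).
    rewrite E. replace (0 * (w - z) ^ n) with (RtoC 0) by ring. rewrite Cmod_0.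
    unfold scal; simpl; unfold mult; simpl. lra.
Qed.

Lemma disc_point (z : C) (e : R) : (0 < e)%R -> exists w, (0 < Cmod (w - z) < e)%R.
Proof.
  intro He. exists (z + RtoC (e / 2)). replace (z + RtoC (e / 2) - z) with (RtoC (e / 2)) by ring.
  rewrite Cmod_R, Rabs_pos_eq; lra.
Qed.

(** The points near which [f] vanishes identically and those with a punctured neighbourhood free of
    zeros form two disjoint open sets covering [D]. Connectedness forbids that both meet [D]. *)
Lemma identity_theorem (D : C -> Prop) (f : C -> C) : connected D -> holomorphic D f ->
  (exists t d, D t /\ (0 < d)%R /\ forall w, (Cmod (w - t) < d)%R -> f w = 0) ->
  forall t, D t -> f t = 0.
Proof.
  intros HD Hf (t0 & d0 & Ht0 & Hd0 & K0) t Ht.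
  set (U := fun z => exists d, (0 < d)%R /\ forall w, (Cmod (w - z) < d)%R -> f w = 0).
  set (V := fun z => exists d, (0 < d)%R /\ forall w, (0 < Cmod (w - z) < d)%R -> f w <> 0).
  assert (HUV : forall z, U z -> V z -> False).
  { intros z (d & Hd & K) (d' & Hd' & K').
    destruct (disc_point z (Rmin d d')) as [w Hw]; [now apply Rmin_pos|].
    pose proof (Rmin_l d d'); pose proof (Rmin_r d d'). apply (K' w); [lra|apply K; lra]. }
  assert (OU : open U).
  { apply open_disc. intros z (d & Hd & K). exists (d / 2)%R. split; [lra|]. intros w Hw.
    exists (d / 2)%R. split; [lra|]. intros w' Hw'. apply K.
    replace (w' - z) with ((w' - w) + (w - z)) by ring. eapply Rle_lt_trans; [apply Cmod_triangle|lra]. }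
  assert (OV : open V).
  { apply open_disc. intros z (d & Hd & K). exists (d / 2)%R. split; [lra|]. intros w Hw.
    destruct (Req_dec (Cmod (w - z)) 0) as [E|E].
    - apply Cmod_eq_0 in E. replace w with z by (replace w with (w - z + z) by ring; rewrite E; ring).
      exists d; auto.
    (* This radius keeps the disc around [w] away from [z], where [f] may vanish. *)
    - pose proof (Cmod_ge_0 (w - z)). exists (Cmod (w - z)). split; [lra|]. intros w' Hw'. apply K.
      replace (w' - z) with ((w' - w) + (w - z)) by ring. split.
      + pose proof (Cmod_triangle ((w' - w) + (w - z)) (- (w' - w))) as T. rewrite Cmod_opp in T.
        replace (w' - w + (w - z) + - (w' - w)) with (w - z) in T by ring. lra.
      + eapply Rle_lt_trans; [apply Cmod_triangle|lra]. }
  assert (HDUV : forall z, D z -> U z \/ V z).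
  { intros z Hz. apply analytic_at_zero_isolated. now apply (proj1 (holomorphic_analytic D f)). }
  destruct (HDUV t Ht) as [(d & Hd & K)|HV].
  - apply K. now rewrite Cmod_sub_diag.
  - exfalso. destruct (HD U V OU OV HDUV) as (z & _ & HzU & HzV); [now exists t0; split;
      [|exists d0]|now exists t|].
    exact (HUV z HzU HzV).
Qed.

(** On the segment from [z] to [w] the real and imaginary parts of [f] are real functions with zero
    derivative, so the real mean value theorem decides. *)
Lemma cdiff_0_const f z d : (forall w, (Cmod (w - z) < d)%R -> cdiff f w 0) ->
  forall w, (Cmod (w - z) < d)%R -> f w = f z.
Proof.
  intros H w Hw. set (g := fun s : R => f (z + RtoC s * (w - z))).
  (* [p] stands for either coordinate; additivity and [|p u| <= |u|] are all that the argument takes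
     from it. *)
  assert (Q : forall p : C -> R, (forall u v : C, p (u - v)%C = p u - p v)%R -> (forall u : C, Rabs (p
    u) <= Cmod u)%R -> p (g 0%R) = p (g 1%R)).
  { intros p Hp Hb. apply (eq_is_derive (V := R_NormedModule) (fun s => p (g s)) 0 1); [|lra].
    intros s Hs. apply is_derive_Reals. intros e He. set (c := z + RtoC s * (w - z)).
    destruct (H c) as (q & Hq & Hq0 & d1 & Hd1 & E).
    { unfold c. replace (z + RtoC s * (w - z) - z) with (RtoC s * (w - z)) by ring.
      rewrite Cmod_mult, Cmod_R, Rabs_pos_eq by lra. pose proof (Cmod_ge_0 (w - z)). nra. }
    set (M := (Cmod (w - z) + 1)%R). pose proof (Cmod_ge_0 (w - z)).
    assert (HM : (0 < M)%R) by (unfold M; lra).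
    destruct (Hq (e / M)%R) as (d2 & Hd2 & K); [now apply Rdiv_lt_0_compat|].
    assert (Hd3 : (0 < Rmin d1 d2 / M)%R) by (apply Rdiv_lt_0_compat; auto; now apply Rmin_pos).
    exists (mkposreal _ Hd3). intros h Hh0 Hh. simpl in Hh.
    assert (Ec : z + RtoC (s + h) * (w - z) - c = RtoC h * (w - z)) by (unfold c; rewrite RtoC_plus; ring).
    assert (Bc : (Cmod (z + RtoC (s + h) * (w - z) - c) < Rmin d1 d2)%R).
    { rewrite Ec, Cmod_mult, Cmod_R. pose proof (Rabs_pos h).
      apply Rle_lt_trans with (Rabs h * M)%R; [unfold M; nra|].
      replace (Rmin d1 d2) with (Rmin d1 d2 / M * M)%R by (field; lra). apply Rmult_lt_compat_r; lra. }
    pose proof (Rmin_l d1 d2); pose proof (Rmin_r d1 d2).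
    specialize (E _ (Rlt_le_trans _ _ _ Bc (Rmin_l d1 d2))).
    specialize (K _ (Rlt_le_trans _ _ _ Bc (Rmin_r d1 d2))).
    unfold g. cbv beta. fold c. rewrite <- Hp, E, Ec. change (@zero R_NormedModule) with 0%R.
    rewrite Rminus_0_r. unfold Rdiv.
    rewrite Rabs_mult, Rabs_inv. set (Q := q (z + RtoC (s + h) * (w - z))) in *.
    rewrite Hq0 in K. replace (Q - 0) with Q in K by ring.
    replace (f c + RtoC h * (w - z) * Q - f c) with (RtoC h * ((w - z) * Q)) by ring.
    assert (P := Hb (RtoC h * ((w - z) * Q))). rewrite !Cmod_mult, Cmod_R in P.
    assert (Ph : (0 < Rabs h)%R) by now apply Rabs_pos_lt.
    apply Rle_lt_trans with (Cmod (w - z) * Cmod Q)%R.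
    - apply Rmult_le_reg_r with (Rabs h); auto. rewrite Rmult_assoc, Rinv_l, Rmult_1_r by lra. lra.
    - pose proof (Cmod_ge_0 Q). apply Rle_lt_trans with (M * Cmod Q)%R; [unfold M; nra|].
      replace e with (M * (e / M))%R by (field; lra). now apply Rmult_lt_compat_l. }
  assert (E0 : g 0%R = f z) by (unfold g; f_equal; ring).
  assert (E1 : g 1%R = f w) by (unfold g; f_equal; ring).
  rewrite <- E0, <- E1. apply injective_projections; symmetry; apply Q.
  - intros [u1 u2] [v1 v2]. simpl. ring.
  - intro u. apply (Rle_trans _ _ _ (Rmax_l _ _) (Rmax_Cmod u)).
  - intros [u1 u2] [v1 v2]. simpl. ring.
  - intro u. apply (Rle_trans _ _ _ (Rmax_r _ _) (Rmax_Cmod u)).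
Qed.

(** * Normal forms modulo the F2 system *)

(** Coefficients as syntax: partial derivatives become computations, mixed ones commute by [ring],
    and identities between reduced forms are left to [field]. *)
Inductive expr :=
| EC (c : C) | EX | EY | EAdd (e f : expr) | EMul (e f : expr) | EInv (e : expr).

Fixpoint eval (e : expr) (p : C * C) : C :=
  match e with
  | EC c => c
  | EX => fst p
  | EY => snd p
  | EAdd e f => eval e p + eval f p
  | EMul e f => eval e p * eval f p
  | EInv e => / eval e p
  end.

Fixpoint Dx (e : expr) : expr :=
  match e with
  | EC _ => EC 0
  | EX => EC 1
  | EY => EC 0
  | EAdd e f => EAdd (Dx e) (Dx f)
  | EMul e f => EAdd (EMul (Dx e) f) (EMul e (Dx f))
  | EInv e => EMul (EMul (EC (- (1))) (Dx e)) (EMul (EInv e) (EInv e))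
  end.

Fixpoint Dy (e : expr) : expr :=
  match e with
  | EC _ => EC 0
  | EX => EC 0
  | EY => EC 1
  | EAdd e f => EAdd (Dy e) (Dy f)
  | EMul e f => EAdd (EMul (Dy e) f) (EMul e (Dy f))
  | EInv e => EMul (EMul (EC (- (1))) (Dy e)) (EMul (EInv e) (EInv e))
  end.

Fixpoint edef (e : expr) (p : C * C) : Prop :=
  match e with
  | EC _ | EX | EY => True
  | EAdd e f | EMul e f => edef e p /\ edef f p
  | EInv e => edef e p /\ eval e p <> 0
  end.

Lemma edef_Dx e p : edef e p -> edef (Dx e) p.
Proof. induction e; simpl; intuition. Qed.

Lemma edef_Dy e p : edef e p -> edef (Dy e) p.
Proof. induction e; simpl; intuition. Qed.

Lemma cdiff_eq f z l m : cdiff f z l -> l = m -> cdiff f z m.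
Proof. now intros H <-. Qed.

Lemma eval_Dx e (z w : C) : edef e (z, w) -> cdiff (fun t => eval e (t, w)) z (eval (Dx e) (z, w)).
Proof.
  induction e; simpl; intro H; auto using cdiff_const, cdiff_id.
  - apply cdiff_plus; intuition.
  - apply (cdiff_mult (fun t => eval e1 (t, w)) (fun t => eval e2 (t, w))); intuition.
  - destruct H as [H H0]. eapply cdiff_eq; [apply (cdiff_inv (fun t => eval e (t, w))); auto|ring].
Qed.

Lemma eval_Dy e (z w : C) : edef e (z, w) -> cdiff (fun t => eval e (z, t)) w (eval (Dy e) (z, w)).
Proof.
  induction e; simpl; intro H; auto using cdiff_const, cdiff_id.
  - apply cdiff_plus; intuition.
  - apply (cdiff_mult (fun t => eval e1 (z, t)) (fun t => eval e2 (z, t))); intuition.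
  - destruct H as [H H0]. eapply cdiff_eq; [apply (cdiff_inv (fun t => eval e (z, t))); auto|ring].
Qed.

(** An identity of polynomials in which each inverse is an atom, hence valid even where [e] is
    undefined. *)
Lemma eval_Dx_Dy e p : eval (Dx (Dy e)) p = eval (Dy (Dx e)) p.
Proof. induction e; simpl; rewrite ?IHe, ?IHe1, ?IHe2; ring. Qed.

Definition F2_disc (p : C * C) : C :=
  fst p * snd p * (1 - fst p) * (1 - snd p) * (1 - fst p - snd p).

Lemma F2_disc_neq0 p : F2_disc p <> 0 ->
  fst p <> 0 /\ snd p <> 0 /\ 1 - fst p <> 0 /\ 1 - snd p <> 0 /\ 1 - fst p - snd p <> 0.
Proof. unfold F2_disc; intro H; repeat split; intro E; apply H; rewrite E; ring. Qed.

Lemma F2_disc_neq0_x (z w : C) : F2_disc (z, w) <> 0 ->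
  exists d, (0 < d)%R /\ forall t, (Cmod (t - z) < d)%R -> F2_disc (t, w) <> 0.
Proof.
  intro H. destruct (ccont_neq0 (fun t => F2_disc (t, w)) z) as (d & Hd & K); auto.
  - unfold F2_disc; simpl. unfold Cminus. repeat apply ccont_mult; repeat apply ccont_plus;
      auto using ccont_const, ccont_id;
    (apply (ccont_ext (fun t => - (1) * t)); [exists 1%R; split; [lra|intros; ring]|apply ccont_mult;
      auto using ccont_const, ccont_id]).
  - exists d; split; auto. intros t Ht. apply Cmod_gt_0. specialize (K t Ht).
    pose proof (Cmod_ge_0 (F2_disc (z, w))). lra.
Qed.

Lemma F2_disc_sym (z w : C) : F2_disc (z, w) = F2_disc (w, z).
Proof. unfold F2_disc; simpl; ring. Qed.

Definition edefined (e : expr) : Prop := forall p, F2_disc p <> 0 -> edef e p.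

Definition eeq (e f : expr) : Prop := forall p, F2_disc p <> 0 -> eval e p = eval f p.

(** Off the singular lines the equality persists along a small horizontal disc, so it may be
    differentiated there. *)
Lemma eeq_Dx e f : edefined e -> edefined f -> eeq e f -> eeq (Dx e) (Dx f).
Proof.
  intros He Hf E [z w] Hp.
  rewrite <- (cdiff_C_derive _ _ _ (eval_Dx f z w (Hf _ Hp))). symmetry. apply cdiff_C_derive.
  destruct (F2_disc_neq0_x z w Hp) as (d & Hd & K).
  apply (cdiff_ext (fun t => eval e (t, w))); [|now apply eval_Dx, He].
  exists d; split; auto.
Qed.

Lemma eeq_Dy e f : edefined e -> edefined f -> eeq e f -> eeq (Dy e) (Dy f).
Proof.
  intros He Hf E [z w] Hp.
  rewrite <- (cdiff_C_derive _ _ _ (eval_Dy f z w (Hf _ Hp))). symmetry. apply cdiff_C_derive.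
  rewrite F2_disc_sym in Hp.
  destruct (F2_disc_neq0_x w z Hp) as (d & Hd & K). rewrite F2_disc_sym in Hp.
  apply (cdiff_ext (fun t => eval e (z, t))); [|now apply eval_Dy, He].
  exists d; split; auto. intros t Ht. apply E. rewrite F2_disc_sym. now apply K.
Qed.

(** * The flat connection of rank 4 attached to the system *)

(* Index of the basis F, F_x, F_y, F_xy of the rank 4 system. *)
Inductive idx := I0 | Ix | Iy | Ixy.

Definition vec := idx -> expr.

Definition esub (e f : expr) : expr := EAdd e (EMul (EC (- (1))) f).
Definition vadd (u v : vec) : vec := fun i => EAdd (u i) (v i).
Definition vscal (e : expr) (v : vec) : vec := fun i => EMul e (v i).
Definition vbasis (i : idx) : vec := fun j =>
  EC (match i, j with I0, I0 | Ix, Ix | Iy, Iy | Ixy, Ixy => 1 | _, _ => 0 end).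

Definition e1x : expr := esub (EC 1) EX.
Definition e1y : expr := esub (EC 1) EY.

Definition vFxx (k : params) : vec :=
  vscal (EInv (EMul EX e1x))
    (vadd (vscal (EMul EX EY) (vbasis Ixy))
    (vadd (vscal (esub (EMul (EC (pa k + pb1 k + 1)) EX) (EC (pc1 k))) (vbasis Ix))
    (vadd (vscal (EMul (EC (pb1 k)) EY) (vbasis Iy)) (vscal (EC (pa k * pb1 k)) (vbasis I0))))).

Definition vFyy (k : params) : vec :=
  vscal (EInv (EMul EY e1y))
    (vadd (vscal (EMul EX EY) (vbasis Ixy))
    (vadd (vscal (esub (EMul (EC (pa k + pb2 k + 1)) EY) (EC (pc2 k))) (vbasis Iy))
    (vadd (vscal (EMul (EC (pb2 k)) EX) (vbasis Ix)) (vscal (EC (pa k * pb2 k)) (vbasis I0))))).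

(* The y-derivative of the first equation and the x-derivative of the second one read
   x(1-x) F_xxy - xy F_xyy = vrem1 and y(1-y) F_xyy - xy F_xxy = vrem2. *)
Definition vrem1 (k : params) : vec :=
  vadd (vscal (EAdd EX (esub (EMul (EC (pa k + pb1 k + 1)) EX) (EC (pc1 k)))) (vbasis Ixy))
    (vadd (vscal (EC (pb1 k * (1 + pa k))) (vbasis Iy)) (vscal (EMul (EC (pb1 k)) EY) (vFyy k))).

Definition vrem2 (k : params) : vec :=
  vadd (vscal (EAdd EY (esub (EMul (EC (pa k + pb2 k + 1)) EY) (EC (pc2 k)))) (vbasis Ixy))
    (vadd (vscal (EC (pb2 k * (1 + pa k))) (vbasis Ix)) (vscal (EMul (EC (pb2 k)) EX) (vFxx k))).

(** Cramer's rule for the two equations above in [F_xxy] and [F_xyy]. The determinant is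
    [xy(1-x-y)], the origin of the singular line [x + y = 1]; a factor [y] cancels here and a factor
    [x] in [vFxyy]. *)
Definition vFxxy (k : params) : vec :=
  vscal (EInv (EMul EX (esub e1x EY))) (vadd (vscal e1y (vrem1 k)) (vscal EX (vrem2 k))).

Definition vFxyy (k : params) : vec :=
  vscal (EInv (EMul EY (esub e1x EY))) (vadd (vscal e1x (vrem2 k)) (vscal EY (vrem1 k))).

(** Connection matrix: row [i] holds the coordinates of the [x]-derivative of the basis element
    [i]. *)
Definition Mx (k : params) (i : idx) : vec :=
  match i with I0 => vbasis Ix | Ix => vFxx k | Iy => vbasis Ixy | Ixy => vFxxy k end.

Definition My (k : params) (i : idx) : vec :=
  match i with I0 => vbasis Iy | Ix => vbasis Ixy | Iy => vFyy k | Ixy => vFxyy k end.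

Definition isum (f : idx -> C) : C := f I0 + f Ix + f Iy + f Ixy.

Definition row_mul (v : vec) (M : idx -> vec) : vec := fun j =>
  EAdd (EAdd (EAdd (EMul (v I0) (M I0 j)) (EMul (v Ix) (M Ix j))) (EMul (v Iy) (M Iy j)))
    (EMul (v Ixy) (M Ixy j)).

(** Covariant derivative: [v] stands for a combination of [F, F_x, F_y, F_xy], differentiated by the
    product rule and reduced again to that basis. *)
Definition nablax (k : params) (v : vec) : vec := fun j => EAdd (Dx (v j)) (row_mul v (Mx k) j).
Definition nablay (k : params) (v : vec) : vec := fun j => EAdd (Dy (v j)) (row_mul v (My k) j).

Lemma edefined_Mx k i j : edefined (Mx k i j).
Proof.
  intros p H. apply F2_disc_neq0 in H as (H1 & H2 & H3 & H4 & H5).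
  destruct i, j; simpl; repeat split; auto;
    apply Cmult_neq_0; auto;
    (intro E; first [apply H3; rewrite <- E; ring | apply H4; rewrite <- E; ring | apply H5;
      rewrite <- E; ring]).
Qed.

Lemma edefined_My k i j : edefined (My k i j).
Proof.
  intros p H. apply F2_disc_neq0 in H as (H1 & H2 & H3 & H4 & H5).
  destruct i, j; simpl; repeat split; auto;
    apply Cmult_neq_0; auto;
    (intro E; first [apply H3; rewrite <- E; ring | apply H4; rewrite <- E; ring | apply H5;
      rewrite <- E; ring]).
Qed.

(** Flatness of the connection: the two sides are the coordinates of the mixed second derivative of
    the basis element [i], taken in the two orders. This is what keeps the four basis elements free
    of hidden relations. *)
Lemma integrability k i j p : F2_disc p <> 0 ->
  eval (Dx (My k i j)) p + isum (fun m => eval (My k i m) p * eval (Mx k m j) p) =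
  eval (Dy (Mx k i j)) p + isum (fun m => eval (Mx k i m) p * eval (My k m j) p).
Proof.
  intro H. apply F2_disc_neq0 in H as (H1 & H2 & H3 & H4 & H5).
  destruct p as [x y]; simpl in *. unfold isum.
  destruct k as [a b1 b2 c1 c2].
  destruct i, j; simpl; field; repeat split; auto;
   (intro E; first [apply H3; rewrite <- E; ring | apply H4; rewrite <- E; ring | apply H5;
     rewrite <- E; ring]).
Qed.

Lemma C_sub_eq0 (z w : C) : z - w = 0 -> z = w.
Proof. intro H. replace z with (z - w + w) by ring. rewrite H. ring. Qed.

Lemma eval_nablax k v j p : eval (nablax k v j) p =
  eval (Dx (v j)) p + isum (fun m => eval (v m) p * eval (Mx k m j) p).
Proof. reflexivity. Qed.

Lemma eval_nablay k v j p : eval (nablay k v j) p =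
  eval (Dy (v j)) p + isum (fun m => eval (v m) p * eval (My k m j) p).
Proof. reflexivity. Qed.

Lemma eval_Dx_nablay k v j p : eval (Dx (nablay k v j)) p = eval (Dx (Dy (v j))) p +
  isum (fun m => eval (Dx (v m)) p * eval (My k m j) p + eval (v m) p * eval (Dx (My k m j)) p).
Proof. reflexivity. Qed.

Lemma eval_Dy_nablax k v j p : eval (Dy (nablax k v j)) p = eval (Dy (Dx (v j))) p +
  isum (fun m => eval (Dy (v m)) p * eval (Mx k m j) p + eval (v m) p * eval (Dy (Mx k m j)) p).
Proof. reflexivity. Qed.

(** By the product rule, all terms containing a derivative of [v] cancel; the rest is the sum of the
    [v i] times the curvature, which vanishes by [integrability]. *)
Lemma nabla_comm k v j : eeq (nablax k (nablay k v) j) (nablay k (nablax k v) j).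
Proof.
  intros p Hp.
  rewrite eval_nablax, eval_nablay, eval_Dx_nablay, eval_Dy_nablax, eval_Dx_Dy.
  unfold isum at 2 4. rewrite !eval_nablay, !eval_nablax.
  apply C_sub_eq0.
  transitivity (isum (fun i => eval (v i) p *
    ((eval (Dx (My k i j)) p + isum (fun m => eval (My k i m) p * eval (Mx k m j) p)) -
     (eval (Dy (Mx k i j)) p + isum (fun m => eval (Mx k i m) p * eval (My k m j) p))))).
  - unfold isum. ring.
  - unfold isum at 1. rewrite !integrability by auto. ring.
Qed.

Definition vdefined (v : vec) : Prop := forall i, edefined (v i).
Definition veq (u v : vec) : Prop := forall i, eeq (u i) (v i).

Lemma vdefined_nablax k v : vdefined v -> vdefined (nablax k v).
Proof.
  intros H i p Hp. split; [now apply edef_Dx, H|].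
  pose proof (fun m => H m p Hp) as Hv. pose proof (fun m => edefined_Mx k m i p Hp) as HM.
  exact (conj (conj (conj (conj (Hv I0) (HM I0)) (conj (Hv Ix) (HM Ix))) (conj (Hv Iy) (HM Iy))) (conj
    (Hv Ixy) (HM Ixy))).
Qed.

Lemma vdefined_nablay k v : vdefined v -> vdefined (nablay k v).
Proof.
  intros H i p Hp. split; [now apply edef_Dy, H|].
  pose proof (fun m => H m p Hp) as Hv. pose proof (fun m => edefined_My k m i p Hp) as HM.
  exact (conj (conj (conj (conj (Hv I0) (HM I0)) (conj (Hv Ix) (HM Ix))) (conj (Hv Iy) (HM Iy))) (conj
    (Hv Ixy) (HM Ixy))).
Qed.

Lemma veq_nablax k u v : vdefined u -> vdefined v -> veq u v -> veq (nablax k u) (nablax k v).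
Proof.
  intros Hu Hv E i p Hp. rewrite !eval_nablax, (eeq_Dx (u i) (v i)) by auto.
  unfold isum. now rewrite !(fun i => E i p Hp).
Qed.

(* Coordinates of the derivative of F, i times in x and j times in y. *)
Definition vR (k : params) (i j : nat) : vec :=
  Nat.iter i (nablax k) (Nat.iter j (nablay k) (vbasis I0)).

Lemma vdefined_R k i j : vdefined (vR k i j).
Proof.
  induction i as [|i IH]; [|now apply vdefined_nablax].
  induction j as [|j IH]; [|now apply vdefined_nablay]. intros m p _. exact I.
Qed.

Lemma vR_Sx k i j : vR k (S i) j = nablax k (vR k i j).
Proof. reflexivity. Qed.

(** In [vR] the [y]-derivatives are applied innermost, so a new one has to be commuted past all
    [x]-derivatives. This is where flatness enters. *)
Lemma vR_Sy k i j : veq (vR k i (S j)) (nablay k (vR k i j)).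
Proof.
  induction i as [|i IH]; [now intros m p Hp|].
  intros m p Hp. rewrite vR_Sx, (veq_nablax k _ (nablay k (vR k i j)));
    auto using vdefined_R, vdefined_nablay.
  now apply nabla_comm.
Qed.

(** * Reduction of differential operators to normal form *)

(* Linear differential operators: the term (e, i, j) stands for e times the derivative, i times in x and
  j times in y. *)
Definition oper := list (expr * nat * nat).

Fixpoint ocoef (l : oper) (i j : nat) : expr :=
  match l with
  | nil => EC 0
  | (e, i', j') :: l => EAdd (if (Nat.eqb i i' && Nat.eqb j j')%bool then e else EC 0) (ocoef l i j)
  end.

(* Normal form of the operator in the basis F, F_x, F_y, F_xy. *)
Fixpoint onf (k : params) (l : oper) : vec := fun m =>
  match l with
  | nil => EC 0
  | (e, i, j) :: l => EAdd (EMul e (vR k i j m)) (onf k l m)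
  end.

Fixpoint odx (l : oper) : oper :=
  match l with nil => nil | (e, i, j) :: l => (Dx e, i, j) :: (e, S i, j) :: odx l end.

Fixpoint ody (l : oper) : oper :=
  match l with nil => nil | (e, i, j) :: l => (Dy e, i, j) :: (e, i, S j) :: ody l end.

(** Required at every point, including singular ones: the coefficients of prolongations are
    polynomials, and [C_derive] in [pde_dx] and [pde_dy] is then a true derivative everywhere. *)
Definition odefined (l : oper) : Prop := forall t, In t l -> forall p, edef (fst (fst t)) p.

Lemma edef_ocoef l i j p : odefined l -> edef (ocoef l i j) p.
Proof.
  induction l as [|[[e i'] j'] l IH]; intro H; [exact I|]. simpl. split.
  - destruct (_ && _)%bool; [apply (H (e, i', j')); now left|exact I].
  - apply IH. intros t Ht. apply H. now right.
Qed.

Lemma edefined_onf k l m : odefined l -> edefined (onf k l m).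
Proof.
  induction l as [|[[e i'] j'] l IH]; intros H p Hp; [exact I|]. simpl. repeat split.
  - apply (H (e, i', j')); now left.
  - now apply vdefined_R.
  - apply IH; auto. intros t Ht. apply H. now right.
Qed.

Lemma odefined_odx l : odefined l -> odefined (odx l).
Proof.
  induction l as [|[[e i] j] l IH]; intro H; [exact H|].
  assert (He : forall p, edef e p) by (apply (H (e, i, j)); now left).
  intros t [<-|[<-|Ht]] p; simpl; auto using edef_Dx.
  apply IH; auto. intros t' Ht'. apply H. now right.
Qed.

Lemma odefined_ody l : odefined l -> odefined (ody l).
Proof.
  induction l as [|[[e i] j] l IH]; intro H; [exact H|].
  assert (He : forall p, edef e p) by (apply (H (e, i, j)); now left).
  intros t [<-|[<-|Ht]] p; simpl; auto using edef_Dy.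
  apply IH; auto. intros t' Ht'. apply H. now right.
Qed.

Lemma ocoef_odx l i j p : eval (ocoef (odx l) i j) p =
  eval (Dx (ocoef l i j)) p + match i with O => 0 | S i' => eval (ocoef l i' j) p end.
Proof.
  induction l as [|[[e i1] j1] l IH]; [destruct i; simpl; ring|].
  cbn [odx ocoef]. cbn [eval Dx]. rewrite IH.
  destruct i as [|i]; cbn [Nat.eqb andb eval Dx ocoef]; destruct (_ && _)%bool; cbn [eval Dx];
    try destruct (_ && _)%bool; cbn [eval Dx]; ring.
Qed.

Lemma ocoef_ody l i j p : eval (ocoef (ody l) i j) p =
  eval (Dy (ocoef l i j)) p + match j with O => 0 | S j' => eval (ocoef l i j') p end.
Proof.
  induction l as [|[[e i1] j1] l IH]; [destruct j; simpl; ring|].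
  cbn [ody ocoef]. cbn [eval Dy]. rewrite IH.
  destruct j as [|j]; cbn [Nat.eqb eval Dy ocoef]; rewrite ?Bool.andb_false_r; destruct (_ && _)%bool;
    cbn [eval Dy];
    try destruct (_ && _)%bool; cbn [eval Dy]; ring.
Qed.

Lemma onf_odx k l m p : eval (onf k (odx l) m) p = eval (nablax k (onf k l) m) p.
Proof.
  rewrite eval_nablax. induction l as [|[[e i] j] l IH]; [unfold isum; simpl; ring|].
  cbn [odx onf eval Dx]. rewrite IH, vR_Sx, eval_nablax. unfold isum. ring.
Qed.

Lemma onf_ody k l m p : F2_disc p <> 0 -> eval (onf k (ody l) m) p = eval (nablay k (onf k l) m) p.
Proof.
  intro Hp. rewrite eval_nablay. induction l as [|[[e i] j] l IH]; [unfold isum; simpl; ring|].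
  cbn [ody onf eval Dy]. rewrite IH, (vR_Sy k i j m p Hp), eval_nablay. unfold isum. ring.
Qed.

Definition oeq1 (k : params) : oper :=
  (EMul EX e1x, 2%nat, 0%nat) :: (EMul (EC (- (1))) (EMul EX EY), 1%nat, 1%nat) ::
  (esub (EC (pc1 k)) (EMul (EC (pa k + pb1 k + 1)) EX), 1%nat, 0%nat) ::
  (EMul (EC (- pb1 k)) EY, 0%nat, 1%nat) :: (EC (- (pa k * pb1 k)), 0%nat, 0%nat) :: nil.

Definition oeq2 (k : params) : oper :=
  (EMul EY e1y, 0%nat, 2%nat) :: (EMul (EC (- (1))) (EMul EX EY), 1%nat, 1%nat) ::
  (esub (EC (pc2 k)) (EMul (EC (pa k + pb2 k + 1)) EY), 0%nat, 1%nat) ::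
  (EMul (EC (- pb2 k)) EX, 1%nat, 0%nat) :: (EC (- (pa k * pb2 k)), 0%nat, 0%nat) :: nil.

Ltac nonzero_disc H3 H4 H5 :=
  let E := fresh "E" in intro E; first [apply H3; rewrite <- E; ring | apply H4; rewrite <- E;
    ring | apply H5; rewrite <- E; ring].

(** Both equations reduce to zero by the choice of [vFxx] and [vFyy]. Differentiating an operator
    amounts to applying the connection to its normal form, and a normal form that vanishes off the
    singular lines has vanishing derivatives there. *)
Lemma F2_prolongation_oper k L : F2_prolongation k L ->
  exists l, odefined l /\ (forall i j p, L i j p = eval (ocoef l i j) p) /\
    forall m p, F2_disc p <> 0 -> eval (onf k l m) p = 0.
Proof.
  induction 1 as [| |L HL (l & Hd & Hc & Hn)|L HL (l & Hd & Hc & Hn)].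
  - exists (oeq1 k). split; [|split].
    + intros t Ht p. simpl in Ht. decompose [or] Ht; subst; simpl; tauto.
    + intros i j p. destruct i as [|[|[|i]]], j as [|[|j]]; simpl; ring.
    + intros m p Hp. apply F2_disc_neq0 in Hp as (H1 & H2 & H3 & H4 & H5). destruct p as [x y]; simpl in *.
      destruct m; simpl; field; repeat split; auto; nonzero_disc H3 H4 H5.
  - exists (oeq2 k). split; [|split].
    + intros t Ht p. simpl in Ht. decompose [or] Ht; subst; simpl; tauto.
    + intros i j p. destruct i as [|[|i]], j as [|[|[|j]]]; simpl; ring.
    + intros m p Hp. apply F2_disc_neq0 in Hp as (H1 & H2 & H3 & H4 & H5). destruct p as [x y]; simpl in *.
      destruct m; simpl; field; repeat split; auto; nonzero_disc H3 H4 H5.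
  - exists (odx l). split; [now apply odefined_odx|split].
    + intros i j p. rewrite ocoef_odx. unfold pde_dx. f_equal; [|destruct i; auto].
      destruct p as [x y]; simpl. apply cdiff_C_derive.
      replace (fun z => L i j (z, y)) with (fun z => eval (ocoef l i j) (z, y))
        by (apply functional_extensionality; intro; now rewrite Hc).
      now apply eval_Dx, edef_ocoef.
    + intros m p Hp. rewrite onf_odx, eval_nablax.
      assert (Z : eval (Dx (onf k l m)) p = 0).
      { change (RtoC 0) with (eval (Dx (EC 0)) p).
        apply eeq_Dx; [now apply edefined_onf|now intros ? _|exact (Hn m)|exact Hp]. }
      rewrite Z.
      unfold isum. rewrite !Hn by auto. simpl. ring.
  - exists (ody l). split; [now apply odefined_ody|split].
    + intros i j p. rewrite ocoef_ody. unfold pde_dy. f_equal; [|destruct j; auto].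
      destruct p as [x y]; simpl. apply cdiff_C_derive.
      replace (fun z => L i j (x, z)) with (fun z => eval (ocoef l i j) (x, z))
        by (apply functional_extensionality; intro; now rewrite Hc).
      now apply eval_Dy, edef_ocoef.
    + intros m p Hp. rewrite onf_ody, eval_nablay by auto.
      assert (Z : eval (Dy (onf k l m)) p = 0).
      { change (RtoC 0) with (eval (Dy (EC 0)) p).
        apply eeq_Dy; [now apply edefined_onf|now intros ? _|exact (Hn m)|exact Hp]. }
      rewrite Z.
      unfold isum. rewrite !Hn by auto. simpl. ring.
Qed.

Lemma ocoef_app l l' i j p : eval (ocoef (l ++ l') i j) p = eval (ocoef l i j) p + eval (ocoef l' i j) p.
Proof. induction l as [|[[e i1] j1] l IH]; simpl; [ring|]. rewrite IH. ring. Qed.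

Lemma onf_app k l l' m p : eval (onf k (l ++ l') m) p = eval (onf k l m) p + eval (onf k l' m) p.
Proof. induction l as [|[[e i1] j1] l IH]; simpl; [ring|]. rewrite IH. ring. Qed.

Definition oscal (c : C) (l : oper) : oper := map (fun t => (EMul (EC c) (fst (fst t)), snd (fst t), snd
  t)) l.

Lemma ocoef_scal c l i j p : eval (ocoef (oscal c l) i j) p = c * eval (ocoef l i j) p.
Proof. induction l as [|[[e i1] j1] l IH]; simpl; [ring|]. rewrite IH.
destruct (_ && _)%bool; simpl; ring. Qed.

Lemma onf_scal k c l m p : eval (onf k (oscal c l) m) p = c * eval (onf k l m) p.
Proof. induction l as [|[[e i1] j1] l IH]; simpl; [ring|]. rewrite IH. ring. Qed.

(** The operator depends on [p]: a holomorphic multiplier is replaced by its value [g p], which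
    suffices because nothing is differentiated after a multiplication. *)
Lemma F2_follows_oper k U L p : F2_follows k U L -> F2_disc p <> 0 ->
  exists l, (forall i j, L i j p = eval (ocoef l i j) p) /\ forall m, eval (onf k l m) p = 0.
Proof.
  intros HL Hp. induction HL as [L HL|L M HL (l & Hc & Hn) HM (l' & Hc' & Hn')|g L _ HL (l & Hc & Hn)].
  - destruct (F2_prolongation_oper k L HL) as (l & _ & Hc & Hn). exists l; split; auto.
  - exists (l ++ l'). split; intros.
    + rewrite ocoef_app. unfold pde_add. now rewrite Hc, Hc'.
    + rewrite onf_app, Hn, Hn'. ring.
  - exists (oscal (g p) l). split; intros.
    + rewrite ocoef_scal. unfold pde_mul. now rewrite Hc.
    + rewrite onf_scal, Hn. ring.
Qed.

(** * Consequences of order 2 *)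

Fixpoint csum (n : nat) (f : nat -> C) : C :=
  match n with O => 0 | S n' => csum n' f + f n' end.

Lemma csum_ext n (f g : nat -> C) : (forall i, f i = g i) -> csum n f = csum n g.
Proof. intro H; induction n; simpl; congruence. Qed.

Lemma csum_0 n (f : nat -> C) : (forall i, f i = 0) -> csum n f = 0.
Proof. intro H; induction n as [|n IH]; simpl; [auto|]. rewrite IH, H. ring. Qed.

Lemma csum_plus n (f g : nat -> C) : csum n (fun i => f i + g i) = csum n f + csum n g.
Proof. induction n as [|n IH]; simpl; [ring|]. rewrite IH. ring. Qed.

Lemma csum_single n i0 (f : nat -> C) : (forall i, i <> i0 -> f i = 0) -> csum n f = if Nat.ltb i0 n
  then f i0 else 0.
Proof.
  intro H. induction n as [|n IH]; [reflexivity|]. simpl. rewrite IH.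
  destruct (Nat.ltb_spec i0 n), (Nat.ltb_spec i0 (S n)); try lia.
  - rewrite (H n) by lia. ring.
  - replace n with i0 by lia. ring.
  - rewrite (H n) by lia. ring.
Qed.

Lemma csum_trunc3 n (f : nat -> C) : (forall i, (3 <= i)%nat -> f i = 0) -> csum (3 + n) f = f 0%nat + f
  1%nat + f 2%nat.
Proof.
  intro H. induction n as [|n IH]; [simpl; ring|]. rewrite Nat.add_succ_r. simpl csum at 1.
  change (csum (3 + n) f + f (3 + n)%nat = f 0%nat + f 1%nat + f 2%nat).
  rewrite IH, (H (3 + n)%nat) by lia. ring.
Qed.

(** The list of an operator may mention a derivative several times with cancelling coefficients.
    Collecting terms by derivative makes it possible to use that the total coefficients of order at
    least 3 vanish. *)
Lemma onf_csum k l m p : exists N, forall n, (N <= n)%nat ->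
  eval (onf k l m) p = csum n (fun i => csum n (fun j => eval (ocoef l i j) p * eval (vR k i j m) p)).
Proof.
  induction l as [|[[e i0] j0] l [N IH]].
  - exists 0%nat. intros n _. simpl.
    symmetry. apply csum_0. intro i. apply csum_0. intro j. ring.
  - exists (S (N + i0 + j0)). intros n Hn. simpl. rewrite (IH n) by lia.
    transitivity (csum n (fun i => csum n (fun j => eval (if (Nat.eqb i i0 && Nat.eqb j j0)%bool then e
      else EC 0) p * eval (vR k i j m) p) + csum n (fun j => eval (ocoef l i j) p * eval (vR k i j m) p))).
    2:{ apply csum_ext. intro i. rewrite <- csum_plus. apply csum_ext. intro j. ring. }
    rewrite csum_plus. f_equal.
    rewrite (csum_single n i0).
    + destruct (Nat.ltb_spec i0 n); [|lia]. rewrite (csum_single n j0).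
      * destruct (Nat.ltb_spec j0 n); [|lia]. now rewrite !Nat.eqb_refl.
      * intros j Hj. apply Nat.eqb_neq in Hj. rewrite Hj, Bool.andb_false_r. simpl. ring.
    + intros i Hi. apply Nat.eqb_neq in Hi. rewrite Hi. simpl.
      apply csum_0. intro j. ring.
Qed.

Lemma eval_nablax_basis k i m p : eval (nablax k (vbasis i) m) p = eval (Mx k i m) p.
Proof. rewrite eval_nablax. unfold isum. destruct i; cbn [vbasis eval Dx]; ring. Qed.

Lemma eval_nablay_basis k i m p : eval (nablay k (vbasis i) m) p = eval (My k i m) p.
Proof. rewrite eval_nablay. unfold isum. destruct i; cbn [vbasis eval Dy]; ring. Qed.

Lemma vdefined_basis i : vdefined (vbasis i).
Proof. intros m p _. exact I. Qed.

Lemma veq_nablay k u v : vdefined u -> vdefined v -> veq u v -> veq (nablay k u) (nablay k v).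
Proof.
  intros Hu Hv E i p Hp. rewrite !eval_nablay, (eeq_Dy (u i) (v i)) by auto.
  unfold isum. now rewrite !(fun i => E i p Hp).
Qed.

Lemma vR_10 k m : eeq (vR k 1 0 m) (vbasis Ix m).
Proof. intros p _. apply eval_nablax_basis. Qed.

Lemma vR_01 k m : eeq (vR k 0 1 m) (vbasis Iy m).
Proof. intros p _. apply eval_nablay_basis. Qed.

Lemma vR_11 k m : eeq (vR k 1 1 m) (vbasis Ixy m).
Proof.
  intros p Hp. rewrite vR_Sx, (veq_nablax k _ (vbasis Iy)); auto using vdefined_R, vdefined_basis.
  - apply eval_nablax_basis.
  - exact (vR_01 k).
Qed.

Lemma vR_20 k m : eeq (vR k 2 0 m) (vFxx k m).
Proof.
  intros p Hp. rewrite vR_Sx, (veq_nablax k _ (vbasis Ix)); auto using vdefined_R, vdefined_basis.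
  - apply eval_nablax_basis.
  - exact (vR_10 k).
Qed.

Lemma vR_02 k m : eeq (vR k 0 2 m) (vFyy k m).
Proof.
  intros p Hp. rewrite (vR_Sy k 0 1 m p Hp), (veq_nablay k _ (vbasis Iy));
    auto using vdefined_R, vdefined_basis.
  - apply eval_nablay_basis.
  - exact (vR_01 k).
Qed.

(** The four components of the vanishing normal form express the coefficients of [F], [F_x], [F_y]
    and [F_xy] through those of [F_xx] and [F_yy]. The combination of the two equations that has the
    same [F_xx] and [F_yy] terms satisfies the same relations, so it agrees with [L]. *)
Lemma F2_follows_order2 k U L p : F2_follows k U L -> F2_disc p <> 0 ->
  (forall i j, (3 <= i + j)%nat -> L i j p = 0) ->
  exists lam mu, forall i j, L i j p = lam * F2_eq1 k i j p + mu * F2_eq2 k i j p.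
Proof.
  intros HL Hp H3. destruct (F2_follows_oper k U L p HL Hp) as (l & Hc & Hn).
  assert (Q : forall m, L 0%nat 0%nat p * eval (vR k 0 0 m) p + L 0%nat 1%nat p * eval (vR k 0 1 m) p +
    L 0%nat 2%nat p * eval (vR k 0 2 m) p
    + L 1%nat 0%nat p * eval (vR k 1 0 m) p + L 1%nat 1%nat p * eval (vR k 1 1 m) p + L 2%nat 0%nat p *
        eval (vR k 2 0 m) p = 0).
  { intro m. rewrite <- (Hn m). destruct (onf_csum k l m p) as [N HN]. rewrite (HN (3 + N)%nat) by lia.
    assert (E : forall i, csum (3 + N) (fun j => eval (ocoef l i j) p * eval (vR k i j m) p) =
       L i 0%nat p * eval (vR k i 0 m) p + L i 1%nat p * eval (vR k i 1 m) p + L i 2%nat p * eval (vR k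
         i 2 m) p).
    { intro i. rewrite csum_trunc3; [now rewrite !Hc|]. intros j Hj. rewrite <- Hc, H3 by lia. ring. }
    rewrite csum_trunc3.
    - rewrite !E. rewrite (H3 1%nat 2%nat), (H3 2%nat 1%nat), (H3 2%nat 2%nat) by lia. ring.
    - intros i Hi. rewrite E, (H3 i 0%nat), (H3 i 1%nat), (H3 i 2%nat) by lia. ring. }
  assert (Q' : forall m, L 0%nat 0%nat p * eval (vbasis I0 m) p + L 0%nat 1%nat p * eval (vbasis Iy m) p
    + L 0%nat 2%nat p * eval (vFyy k m) p + L 1%nat 0%nat p * eval (vbasis Ix m) p
    + L 1%nat 1%nat p * eval (vbasis Ixy m) p + L 2%nat 0%nat p * eval (vFxx k m) p = 0).
  { intro m. rewrite <- (vR_10 k m p Hp), <- (vR_01 k m p Hp), <- (vR_11 k m p Hp), <- (vR_20 k m p Hp),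
      <- (vR_02 k m p Hp).
    exact (Q m). }
  clear Q. rename Q' into Q.
  apply F2_disc_neq0 in Hp as (H1 & H2 & H4 & H5 & H6).
  destruct p as [x y]; simpl in H1, H2, H4, H5, H6.
  (* Forced by the [F_xx] and [F_yy] terms, each of which occurs in only one of the two
     equations. *)
  exists (L 2%nat 0%nat (x, y) / (x * (1 - x))), (L 0%nat 2%nat (x, y) / (y * (1 - y))).
  pose proof (Q I0) as Q0. pose proof (Q Ix) as Q1. pose proof (Q Iy) as Q2. pose proof (Q Ixy) as Q3.
  clear Q.
  destruct k as [a b1 b2 c1 c2]. simpl in Q0, Q1, Q2, Q3.
  intros i j. destruct i as [|[|[|i]]], j as [|[|[|j]]]; simpl; try (rewrite H3 by lia; ring).
  - apply C_sub_eq0. etransitivity; [|exact Q0]. field; repeat split; auto; nonzero_disc H4 H5 H6.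
  - apply C_sub_eq0. etransitivity; [|exact Q2]. field; repeat split; auto; nonzero_disc H4 H5 H6.
  - field; auto.
  - apply C_sub_eq0. etransitivity; [|exact Q1]. field; repeat split; auto; nonzero_disc H4 H5 H6.
  - apply C_sub_eq0. etransitivity; [|exact Q3]. field; repeat split; auto; nonzero_disc H4 H5 H6.
  - field; auto.
Qed.

(** * The curve and the parameters *)

Lemma C_integral (z w : C) : z * w = 0 -> z = 0 \/ w = 0.
Proof.
  intro H. destruct (classic (z = 0)) as [|Hz]; auto. destruct (classic (w = 0)) as [|Hw]; auto.
  exfalso. now apply (Cmult_neq_0 z w).
Qed.

Lemma C_cancel (z w : C) : z <> 0 -> z * w = 0 -> w = 0.
Proof. intros Hz H. now apply C_integral in H as [|]. Qed.

Lemma RtoC_neq0 (r : R) : r <> 0%R -> RtoC r <> 0.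
Proof. intros H E. apply H. now apply (f_equal fst) in E. Qed.

Lemma C_sqrt_exists (z : C) : exists s, s ^ 2 = z.
Proof.
  destruct z as [u v]. set (m := Cmod (u, v)).
  assert (Hm : (m * m = u * u + v * v)%R).
  { unfold m, Cmod; simpl. rewrite sqrt_sqrt; [ring|nra]. }
  assert (Hu : (Rabs u <= m)%R) by (apply (re_le_Cmod (u, v))).
  pose proof (Rle_abs u) as U1. pose proof (Rle_abs (- u)) as U2. rewrite Rabs_Ropp in U2.
  set (p := sqrt ((m + u) / 2)). set (q := sqrt ((m - u) / 2)).
  assert (Hp : (p * p = (m + u) / 2)%R) by (apply sqrt_sqrt; lra).
  assert (Hq : (q * q = (m - u) / 2)%R) by (apply sqrt_sqrt; lra).
  assert (Pp : (0 <= p)%R) by apply sqrt_pos. assert (Pq : (0 <= q)%R) by apply sqrt_pos.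
  assert (Hpq : (2 * (p * q) = Rabs v)%R).
  { apply Rsqr_inj; [nra|apply Rabs_pos|]. rewrite <- Rsqr_abs. unfold Rsqr.
    replace (2 * (p * q) * (2 * (p * q)))%R with (4 * ((p * p) * (q * q)))%R by ring. rewrite Hp, Hq. nra. }
  destruct (Rle_dec 0 v) as [Hv|Hv].
  - exists (p, q). rewrite Rabs_pos_eq in Hpq by lra. apply injective_projections; simpl; nra.
  - exists (p, (- q)%R). rewrite Rabs_left in Hpq by lra. apply injective_projections; simpl; nra.
Qed.

(** * Polynomial identities along a nonconstant function *)

Fixpoint peval (l : list C) (u : C) : C :=
  match l with nil => 0 | c :: l => c + u * peval l u end.

(** If [l] represents [P], this represents [n P + u P']; for [n = 1] it is the derivative of
    [u P(u)]. *)
Fixpoint pweight (n : nat) (l : list C) : list C :=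
  match l with nil => nil | c :: l => RtoC (INR n) * c :: pweight (S n) l end.

Lemma cdiff_peval (u : C -> C) (t du : C) : cdiff u t du ->
  forall l n, exists d, cdiff (fun w => peval l (u w)) t (d * du) /\
    peval (pweight n l) (u t) = RtoC (INR n) * peval l (u t) + u t * d.
Proof.
  intros Hu l. induction l as [|c l IH]; intro n.
  - exists (RtoC 0). split; [eapply cdiff_eq; [apply (cdiff_const 0)|ring]|simpl; ring].
  - destruct (IH (S n)) as (d & Hd & E). exists (peval l (u t) + u t * d). split.
    + eapply cdiff_eq; [apply (cdiff_plus (fun _ => c) (fun w => u w * peval l (u w)));
        [apply cdiff_const|apply cdiff_mult; [exact Hu|exact Hd]]|]. simpl. ring.
    + simpl pweight. simpl peval. rewrite E, S_INR, RtoC_plus. ring.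
Qed.

Lemma pweight_zero l : forall n, (0 < n)%nat -> List.Forall (fun c : C => c = 0) (pweight n l) ->
  List.Forall (fun c : C => c = 0) l.
Proof.
  induction l as [|c l IH]; intros n Hn H; [constructor|].
  inversion H; subst. constructor; [|now apply (IH (S n)); [lia|]].
  apply (C_cancel (RtoC (INR n))); auto. apply RtoC_neq0. apply not_0_INR. lia.
Qed.

Lemma length_pweight l : forall n, length (pweight n l) = length l.
Proof. induction l; simpl; intros; auto. Qed.

Lemma cdiff_0_of_zero (f : C -> C) (t l : C) :
  (exists d, (0 < d)%R /\ forall w, (Cmod (w - t) < d)%R -> f w = 0) -> cdiff f t l -> l = 0.
Proof.
  intros (d & Hd & K) H. rewrite <- (cdiff_C_derive _ _ _ H). apply cdiff_C_derive.
  apply (cdiff_ext (fun _ => 0)); [|apply cdiff_const]. exists d; split; auto. intros. now rewrite K.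
Qed.

Lemma disc_nbhd (z w : C) (d : R) : (Cmod (w - z) < d)%R ->
  exists e, (0 < e)%R /\ forall v, (Cmod (v - w) < e)%R -> (Cmod (v - z) < d)%R.
Proof.
  intro H. exists (d - Cmod (w - z))%R. split; [lra|]. intros v Hv.
  replace (v - z) with ((v - w) + (w - z)) by ring. eapply Rle_lt_trans; [apply Cmod_triangle|lra].
Qed.

(** Differentiating [c + u P(u) = 0] and dividing by [u'] gives a shorter identity, whose
    coefficients are positive multiples of those of [P]. By induction [P] vanishes, and then so does
    [c]. *)
Lemma peval_zero_on_disc (u du : C -> C) (t0 : C) (d : R) : (0 < d)%R ->
  (forall t, (Cmod (t - t0) < d)%R -> cdiff u t (du t) /\ du t <> 0) ->
  forall l, (forall t, (Cmod (t - t0) < d)%R -> peval l (u t) = 0) -> List.Forall (fun c : C => c = 0) l.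
Proof.
  intros Hd Hu l. remember (length l) as n eqn:Hn. revert l Hn.
  induction n as [|n IH]; intros [|c l] Hn H; try discriminate; [constructor|].
  assert (Hl : List.Forall (fun c : C => c = 0) l).
  { apply (pweight_zero l 1); [lia|]. apply IH; [rewrite length_pweight; now inversion Hn|].
    intros t Ht. destruct (Hu t Ht) as [Hut Hdu].
    destruct (cdiff_peval u t (du t) Hut l 1) as (e & He & E). rewrite E.
    assert (Hz : du t * peval l (u t) + u t * (e * du t) = 0).
    { apply (cdiff_0_of_zero (fun w => peval (c :: l) (u w)) t).
      - destruct (disc_nbhd t0 t d Ht) as (e' & He' & K). exists e'; split; auto.
      - simpl. eapply cdiff_eq; [apply (cdiff_plus (fun _ => c) (fun w => u w * peval l (u w)));
          [apply cdiff_const|apply cdiff_mult; [exact Hut|exact He]]|]. cbv beta. ring. }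
    apply (C_cancel (du t)); auto. etransitivity; [|exact Hz]. simpl INR. ring. }
  constructor; auto. assert (Hz : forall v, peval l v = 0).
  { intro v. clear -Hl. induction Hl as [|c l -> Hl IH]; simpl; auto. rewrite IH. ring. }
  specialize (H t0). simpl in H. rewrite Hz in H. rewrite <- H; [ring|]. now rewrite Cmod_sub_diag.
Qed.

(** * Algebra of the curve and of the parameter relations *)

(* [p, q, p', q'] are the first and second derivatives of [x] and [y]; the first hypothesis says that
   the curve is tangent to one of the two null directions of the binary quadratic form. *)
Lemma slope_derivative (x y p q p' q' : C) :
  y * (1 - y) * p ^ 2 + 2 * (1 - x) * (1 - y) * p * q + x * (1 - x) * q ^ 2 = 0 ->
  (q * (1 - 2 * y)) * p ^ 2 + 2 * y * (1 - y) * p * p'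
    + 2 * (- p * (1 - y) - q * (1 - x)) * p * q + 2 * (1 - x) * (1 - y) * (p' * q + p * q')
    + p * (1 - 2 * x) * q ^ 2 + 2 * x * (1 - x) * q * q' = 0 ->
  1 - x <> 0 -> 1 - x - y <> 0 -> q <> 0 ->
  2 * (1 - x) * (1 - y) * (p' * q - p * q') + p * q * (p * (1 - y) - q * (1 - x)) = 0.
Proof.
  (* The goal is the numerator of the logarithmic derivative of [(1-y) p^2 / ((1-x) q^2)]. Up to the
     factor [2(1-y)], [al] is the [p]-derivative of the form, so it vanishes only on a double null
     direction, which means [x + y = 1]. *)
  intros HE HE' Hx Hxy Hq. set (al := y * p + (1 - x) * q).
  apply (C_cancel al).
  - intro Ha. assert (H1 : (1 - y) * p + x * q = 0).
    { apply (C_cancel ((1 - x) * q)); [now apply Cmult_neq_0|]. etransitivity; [|exact HE].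
      transitivity ((1 - y) * p * al + (1 - x) * q * ((1 - y) * p + x * q)); [rewrite Ha|unfold al]; ring. }
    apply Hq, (C_cancel (1 - x - y)); auto.
    transitivity ((1 - y) * al - y * ((1 - y) * p + x * q)); [unfold al; ring|]. rewrite Ha, H1. ring.
  - match type of HE with ?e = _ => match type of HE' with ?e' = _ =>
      transitivity ((1 - x) * q * e' + (p * q - 2 * (1 - x) * q') * e); [unfold al;
        ring|rewrite HE, HE'; ring] end end.
Qed.

(** Here [u1] and [u2] are the derivatives of the parameter. Subtracting [p] times the second first
    order relation from [q] times the first removes [A] and also [u2]. The leading relations give
    [lam x = 4 u1^2] and [mu Q = -4 u1^2], with [Q = - kap y], and a polynomial in [u] and [s]
    remains. *)
Lemma param_relation (a b1 b2 c1 c2 x y p q p' q' A lam mu u s u1 u2 : C) :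
  x = 1 - u ^ 2 -> (s ^ 2 - 1) * (1 - y) = (u + s) ^ 2 ->
  p = - (2) * u * u1 -> (s ^ 2 - 1) * q = - (2) * (u + s) * u1 ->
  p' = - (2) * (u1 ^ 2 + u * u2) -> (s ^ 2 - 1) * q' = - (2) * (u1 ^ 2 + (u + s) * u2) ->
  p ^ 2 = lam * (x * (1 - x)) -> q ^ 2 = mu * (y * (1 - y)) ->
  p' + A * p = lam * (c1 - (a + b1 + 1) * x) - mu * (b2 * x) ->
  q' + A * q = mu * (c2 - (a + b2 + 1) * y) - lam * (b1 * y) ->
  s ^ 2 - 1 <> 0 -> x <> 0 -> y <> 0 -> u <> 0 -> u + s <> 0 -> u1 <> 0 ->
  (c1 - 2 * b1) * (u + s) * (u ^ 2 + 2 * u * s + 1) + (c2 - 2 * b2) * (s ^ 2 - 1) * u * (1 - u ^ 2)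
  + s * (1 / 2 - (a + 1 - b1 - b2)) * (1 - u ^ 2) * (u ^ 2 + 2 * u * s + 1) = 0.
Proof.
  intros Ex Ey Ep Eq Ep' Eq' Hlam Hmu H1 H2 Hk Hx Hy Hu Hus Hu1.
  set (Q := u ^ 2 + 2 * u * s + 1). set (kap := s ^ 2 - 1) in *.
  assert (EQ : kap * y = - Q).
  { transitivity (kap - kap * (1 - y)); [ring|]. rewrite Ey. unfold kap, Q. ring. }
  assert (Elam : lam * x = 4 * u1 ^ 2).
  { apply C_sub_eq0, (C_cancel (u ^ 2)); [now apply Cpow_nz|].
    transitivity (lam * (x * (1 - x)) - p ^ 2); [rewrite Ep, Ex; ring|rewrite Hlam; ring]. }
  assert (Emu : mu * Q = - (4) * u1 ^ 2).
  { apply C_sub_eq0, (C_cancel ((u + s) ^ 2)); [now apply Cpow_nz|].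
    transitivity ((kap * q) ^ 2 - mu * (kap * y) * (kap * (1 - y))).
    - rewrite Eq, EQ, Ey. ring.
    - transitivity (kap ^ 2 * (q ^ 2 - mu * (y * (1 - y)))); [ring|]. rewrite Hmu. ring. }
  rewrite <- Ex.
  (* After elimination every term is a multiple of [u1^3]; the second derivatives contribute
     [4 s u1^3], the source of [1 / 2] in the condition on [a]. *)
  apply (C_cancel (8 * u1 ^ 3)); [apply Cmult_neq_0; [apply RtoC_neq0; lra|now apply Cpow_nz]|].
  transitivity (x * Q * ((kap * q) * ((p' + A * p) - (lam * (c1 - (a + b1 + 1) * x) - mu * (b2 * x)))
     - p * (kap * (q' + A * q) - (mu * (c2 * kap - (a + b2 + 1) * (kap * y)) - lam * (b1 * (kap * y)))))).
  2:{ rewrite H1. replace (kap * (q' + A * q)) with (kap * (mu * (c2 - (a + b2 + 1) * y) - lam * (b1 *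
    y))) by (rewrite H2; ring). ring. }
  replace (kap * (q' + A * q)) with (kap * q' + A * (kap * q)) by ring.
  rewrite Eq, Eq', Ep, Ep', EQ.
  match goal with |- ?L = ?R => apply C_sub_eq0;
   transitivity ((lam * x - 4 * u1 ^ 2) * (- (2) * u1 * (u + s) * Q * (c1 - (a + b1 + 1) * x) + 2 * u *
     u1 * Q * b1 * Q)
     + (mu * Q + 4 * u1 ^ 2) * (2 * u1 * (u + s) * b2 * x * x + 2 * u * u1 * x * (c2 * kap + (a + b2 +
         1) * Q))) end.
  - rewrite Ex. unfold Q, kap. field.
  - rewrite Elam, Emu. ring.
Qed.

(** Since [q = -p] and [q' = -p'], adding the two first order relations removes [A] and the second
    derivatives. The terms in [a] cancel as well, which is why [a] stays free on the line
    [x + y = 2]. *)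
Lemma param_relation_diag (a b1 b2 c1 c2 x y p q p' q' A lam mu : C) :
  y = 2 - x -> q = - p -> q' = - p' ->
  p ^ 2 = lam * (x * (1 - x)) -> q ^ 2 = mu * (y * (1 - y)) ->
  p' + A * p = lam * (c1 - (a + b1 + 1) * x) - mu * (b2 * x) ->
  q' + A * q = mu * (c2 - (a + b2 + 1) * y) - lam * (b1 * y) ->
  p <> 0 ->
  2 * (c1 - 2 * b1) + x * (- (c1 - 2 * b1) - (c2 - 2 * b2)) = 0.
Proof.
  intros -> -> -> Hlam Hmu H1 H2 Hp.
  apply (C_cancel (p ^ 2)); [now apply Cpow_nz|].
  assert (Hmu' : p ^ 2 = - mu * ((2 - x) * (1 - x))).
  { transitivity ((- p) ^ 2); [ring|]. rewrite Hmu. ring. }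
  transitivity (x * (1 - x) * (2 - x) *
    ((lam * (c1 - (a + b1 + 1) * x) - mu * (b2 * x)) + (mu * (c2 - (a + b2 + 1) * (2 - x)) - lam * (b1 *
      (2 - x))))).
  - transitivity (p ^ 2 * ((2 - x) * (c1 - (a + b1 + 1) * x) - b1 * (2 - x) ^ 2)
      + p ^ 2 * (b2 * x ^ 2 - x * (c2 - (a + b2 + 1) * (2 - x)))); [ring|].
    rewrite Hlam at 1. rewrite Hmu'. ring.
  - rewrite <- H1, <- H2. ring.
Qed.

Lemma pd_form_relations k (U : C * C -> Prop) L (x y A B : C -> C) (h t : C) :
  F2_follows k U L -> F2_disc (x t, y t) <> 0 -> h <> 0 ->
  (forall i j, L i j (x t, y t) = h * pd_form A B x y i j t) ->
  exists lam mu,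
    C_derive x t ^ 2 = lam * (x t * (1 - x t)) /\
    C_derive y t ^ 2 = mu * (y t * (1 - y t)) /\
    2 * C_derive x t * C_derive y t = - (lam + mu) * (x t * y t) /\
    C_derive (C_derive x) t + A t * C_derive x t =
      lam * (pc1 k - (pa k + pb1 k + 1) * x t) - mu * (pb2 k * x t) /\
    C_derive (C_derive y) t + A t * C_derive y t =
      mu * (pc2 k - (pa k + pb2 k + 1) * y t) - lam * (pb1 k * y t).
Proof.
  intros HL Hd Hh H.
  destruct (F2_follows_order2 k U L (x t, y t) HL Hd) as (lam & mu & E).
  { intros i j Hij. rewrite H. destruct i as [|[|[|i]]], j as [|[|[|j]]]; try lia; simpl; ring. }
  assert (Q : forall i j, pd_form A B x y i j t = / h * (lam * F2_eq1 k i j (x t, y t) + mu * F2_eq2 k i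
    j (x t, y t))).
  { intros i j. rewrite <- E, H. field. exact Hh. }
  exists (lam / h), (mu / h).
  pose proof (Q 2%nat 0%nat) as Q1. pose proof (Q 0%nat 2%nat) as Q2. pose proof (Q 1%nat 1%nat) as Q3.
  pose proof (Q 1%nat 0%nat) as Q4. pose proof (Q 0%nat 1%nat) as Q5.
  unfold pd_form, F2_eq1, F2_eq2 in *; cbn [fst snd] in *.
  rewrite Q1, Q2, Q3, Q4, Q5. repeat split; field; auto.
Qed.

Lemma null_direction (x y p q lam mu : C) :
  p ^ 2 = lam * (x * (1 - x)) -> q ^ 2 = mu * (y * (1 - y)) -> 2 * p * q = - (lam + mu) * (x * y) ->
  y * (1 - y) * p ^ 2 + 2 * (1 - x) * (1 - y) * p * q + x * (1 - x) * q ^ 2 = 0.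
Proof.
  intros H1 H2 H3. replace (2 * (1 - x) * (1 - y) * p * q) with ((1 - x) * (1 - y) * (2 * p * q)) by ring.
  rewrite H1, H2, H3. ring.
Qed.

(** Used in both directions: away from the singular lines [x'] and [y'] vanish together, so no
    coordinate is stationary alone. *)
Lemma null_direction_zero (x y p q lam mu : C) : x <> 0 -> y <> 0 -> 1 - x <> 0 ->
  p ^ 2 = lam * (x * (1 - x)) -> q ^ 2 = mu * (y * (1 - y)) -> 2 * p * q = - (lam + mu) * (x * y) ->
  p = 0 -> q = 0.
Proof.
  intros Hx Hy Hx1 H1 H2 H3 ->.
  assert (Hl : lam = 0).
  { apply (C_cancel (x * (1 - x))); [now apply Cmult_neq_0|]. rewrite Cmult_comm, <- H1. ring. }
  assert (Hm : mu = 0).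
  { apply (C_cancel (- (x * y))).
    - intro E. apply (Cmult_neq_0 x y); auto. replace (x * y) with (- - (x * y)) by ring. rewrite E. ring.
    - transitivity (2 * 0 * q); [rewrite H3, Hl; ring|ring]. }
  rewrite Hm in H2. destruct (C_integral q q) as [E|E]; auto. transitivity (q ^ 2); [ring|]. rewrite H2. ring.
Qed.

Lemma cdiff_opp f z l : cdiff f z l -> cdiff (fun w => - f w) z (- l).
Proof.
  intro H. apply (cdiff_ext (fun w => - (1) * f w)); [exists 1%R; split; [lra|intros; ring]|].
  eapply cdiff_eq; [apply cdiff_mult; [apply cdiff_const|exact H]|cbv beta; ring].
Qed.

Lemma cdiff_minus f g z l m : cdiff f z l -> cdiff g z m -> cdiff (fun w => f w - g w) z (l - m).
Proof. intros Hf Hg. apply cdiff_plus; [exact Hf|now apply cdiff_opp]. Qed.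

Lemma cdiff_sqr f z l : cdiff f z l -> cdiff (fun w => f w ^ 2) z (2 * f z * l).
Proof.
  intro H. apply (cdiff_ext (fun w => f w * f w)); [exists 1%R; split; [lra|intros; ring]|].
  eapply cdiff_eq; [apply cdiff_mult; exact H|cbv beta; ring].
Qed.

Ltac cdiff_step :=
  lazymatch goal with
  | |- cdiff (fun _ => ?c) _ _ => apply cdiff_const
  | |- cdiff (fun _ => _ + _) _ _ => apply cdiff_plus
  | |- cdiff (fun _ => _ - _) _ _ => apply cdiff_minus
  | |- cdiff (fun _ => - _) _ _ => apply cdiff_opp
  | |- cdiff (fun _ => _ ^ 2) _ _ => apply cdiff_sqr
  | |- cdiff (fun _ => _ * _) _ _ => apply cdiff_mult
  | |- cdiff _ _ _ => eassumption
  end.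
Ltac cdiff_auto := eapply cdiff_eq; [repeat cdiff_step | cbv beta; try ring].

Lemma analytic_at_opp f z : analytic_at f z -> analytic_at (fun w => - f w) z.
Proof.
  intro H. replace (fun w => - f w) with (fun w => - (1) * f w) by (apply functional_extensionality;
    intro; ring).
  apply analytic_at_mult; auto using analytic_at_const.
Qed.

Lemma analytic_at_minus f g z : analytic_at f z -> analytic_at g z -> analytic_at (fun w => f w - g w) z.
Proof. intros Hf Hg. apply analytic_at_plus; [exact Hf|now apply analytic_at_opp]. Qed.

Lemma analytic_at_sqr f z : analytic_at f z -> analytic_at (fun w => f w ^ 2) z.
Proof.
  intro H. replace (fun w => f w ^ 2) with (fun w => f w * f w) by (apply functional_extensionality;
    intro; ring).
  now apply analytic_at_mult.
Qed.

Ltac analytic_auto := repeat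
  lazymatch goal with
  | |- analytic_at (fun _ => ?c) _ => apply analytic_at_const
  | |- analytic_at (fun _ => _ + _) _ => apply analytic_at_plus
  | |- analytic_at (fun _ => _ - _) _ => apply analytic_at_minus
  | |- analytic_at (fun _ => _ ^ 2) _ => apply analytic_at_sqr
  | |- analytic_at (fun _ => _ * _) _ => apply analytic_at_mult
  | |- analytic_at _ _ => assumption
  end.

(** * From the implied equation to the conic *)

Definition tangent_relations (k : params) (x y A : C -> C) (t lam mu : C) : Prop :=
  C_derive x t ^ 2 = lam * (x t * (1 - x t)) /\
  C_derive y t ^ 2 = mu * (y t * (1 - y t)) /\
  2 * C_derive x t * C_derive y t = - (lam + mu) * (x t * y t) /\
  C_derive (C_derive x) t + A t * C_derive x t =
    lam * (pc1 k - (pa k + pb1 k + 1) * x t) - mu * (pb2 k * x t) /\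
  C_derive (C_derive y) t + A t * C_derive y t =
    mu * (pc2 k - (pa k + pb2 k + 1) * y t) - lam * (pb1 k * y t).

Definition regular_point (k : params) (D : C -> Prop) (x y A : C -> C) (t : C) : Prop :=
  D t /\ F2_disc (x t, y t) <> 0 /\ C_derive x t <> 0 /\ C_derive y t <> 0 /\
  exists lam mu, tangent_relations k x y A t lam mu.

Lemma cdiff_neq0 f z l : cdiff f z l -> f z <> 0 ->
  exists d, (0 < d)%R /\ forall w, (Cmod (w - z) < d)%R -> f w <> 0.
Proof.
  intros H H0. destruct (ccont_neq0 f z (cdiff_ccont _ _ _ H) H0) as (d & Hd & K).
  exists d; split; auto. intros w Hw. apply Cmod_gt_0. specialize (K w Hw). pose proof (Cmod_ge_0 (f z)). lra.
Qed.

(** [F2_disc] along the curve is analytic and not identically zero on the connected set [D], so it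
    is nonzero somewhere in [D']. Near such a point [x'] and [y'] vanish together; if they did so on
    a whole disc, both coordinates would be constant on [D]. *)
Lemma regular_disc_exists k D x y A B : open D -> connected D ->
  (forall t, D t -> analytic_at x t) -> (forall t, D t -> analytic_at y t) ->
  (exists t1 t2 : C, D t1 /\ D t2 /\ (x t1, y t1) <> (x t2, y t2)) ->
  fully_implied2 k D x y A B ->
  (exists t, D t /\ F2_disc (x t, y t) <> 0) ->
  exists t0 d, (0 < d)%R /\ forall t, (Cmod (t - t0) < d)%R -> regular_point k D x y A t.
Proof.
  intros HDo HDc Hx Hy (s1 & s2 & Hs1 & Hs2 & Hne) (U & L & D' & h & _ & HL & HD' & [t1 Ht1] & HD'U & _
    & Hh & HLf) (t2 & Ht2 & Hg2).
  set (g := fun t => F2_disc (x t, y t)).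
  assert (Hg : forall t, D t -> analytic_at g t).
  { intros t Ht. specialize (Hx t Ht). specialize (Hy t Ht). unfold g, F2_disc; cbn [fst snd].
    analytic_auto. }
  pose proof (proj1 (open_disc D') HD') as HD'o.
  assert (HD'D : forall t, D' t -> D t) by (intros t Ht; now destruct (HD'U t Ht)).
  assert (Hrel : forall t, D' t -> g t <> 0 -> exists lam mu, tangent_relations k x y A t lam mu).
  { intros t Ht Hgt. exact (pd_form_relations k U L x y A B (h t) t HL Hgt (Hh t Ht) (HLf t Ht)). }
  assert (H1 : exists t3, D' t3 /\ g t3 <> 0).
  { apply NNPP. intro Q. apply Hg2. apply (identity_theorem D g HDc); auto.
    - now apply holomorphic_analytic.
    - destruct (HD'o t1 Ht1) as (d & Hd & K). exists t1, d. repeat split; auto.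
      intros w Hw. apply NNPP. intro Hw0. apply Q. exists w. auto. }
  destruct H1 as (t3 & Ht3 & Hg3).
  assert (H2 : exists d, (0 < d)%R /\ forall t, (Cmod (t - t3) < d)%R -> D' t /\ g t <> 0).
  { destruct (HD'o t3 Ht3) as (d & Hd & K).
    destruct (cdiff_neq0 g t3 _ (analytic_at_cdiff _ _ (Hg t3 (HD'D _ Ht3))) Hg3) as (d' & Hd' & K').
    exists (Rmin d d'). split; [now apply Rmin_pos|]. intros t Ht.
    pose proof (Rmin_l d d'); pose proof (Rmin_r d d'). split; [apply K; lra|apply K'; lra]. }
  destruct H2 as (d3 & Hd3 & K3).
  assert (Hzero : forall t, (Cmod (t - t3) < d3)%R -> C_derive x t = 0 <-> C_derive y t = 0).
  { intros t Ht. destruct (K3 t Ht) as [HDt Hgt]. destruct (Hrel t HDt Hgt) as (lam & mu & R1 & R2 & R3 & _).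
    apply F2_disc_neq0 in Hgt as (N1 & N2 & N3 & N4 & _). cbn [fst snd] in *. split.
    - now apply (null_direction_zero (x t) (y t) _ _ lam mu).
    - apply (null_direction_zero (y t) (x t) _ _ mu lam); auto.
      transitivity (2 * C_derive x t * C_derive y t); [ring|]. rewrite R3. ring. }
  assert (H4 : exists t4, (Cmod (t4 - t3) < d3)%R /\ C_derive x t4 <> 0).
  { apply NNPP. intro Q.
    assert (Qx : forall t, (Cmod (t - t3) < d3)%R -> C_derive x t = 0).
    { intros t Ht. apply NNPP. intro Q'. apply Q. now exists t. }
    assert (Qc : forall f, (forall t, D t -> analytic_at f t) ->
      (forall t, (Cmod (t - t3) < d3)%R -> C_derive f t = 0) -> forall t, D t -> f t = f t3).
    { intros f Hf Qf t Ht. apply C_sub_eq0. apply (identity_theorem D (fun t => f t - f t3) HDc); auto.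
      - apply holomorphic_analytic. intros w Hw. specialize (Hf w Hw). analytic_auto.
      - exists t3, d3. repeat split; auto. intros w Hw.
        rewrite (cdiff_0_const f t3 d3) with (w := w); auto; [ring|].
        intros v Hv. rewrite <- (Qf v Hv). apply analytic_at_cdiff, Hf, HD'D. now apply K3. }
    apply Hne.
    rewrite (Qc x Hx Qx s1 Hs1), (Qc x Hx Qx s2 Hs2).
    assert (Qy : forall t, (Cmod (t - t3) < d3)%R -> C_derive y t = 0) by (intros t Ht; apply Hzero; auto).
    now rewrite (Qc y Hy Qy s1 Hs1), (Qc y Hy Qy s2 Hs2). }
  destruct H4 as (t4 & Ht4 & Hx4). exists t4.
  destruct (disc_nbhd t3 t4 d3 Ht4) as (e & He & Ke).
  assert (HD4 : D t4) by (apply HD'D; now apply K3).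
  destruct (cdiff_neq0 (C_derive x) t4 _ (analytic_at_cdiff _ _ (analytic_at_C_derive _ _ (Hx t4 HD4)))
    Hx4) as (e' & He' & Ke').
  exists (Rmin e e'). split; [now apply Rmin_pos|]. intros t Ht.
  pose proof (Rmin_l e e'); pose proof (Rmin_r e e').
  assert (Ht' : (Cmod (t - t3) < d3)%R) by (apply Ke; lra).
  destruct (K3 t Ht') as [HDt Hgt]. assert (Hxt : C_derive x t <> 0) by (apply Ke'; lra).
  repeat split; auto. intro Q. apply Hxt. now apply Hzero.
Qed.

(** The derivative of the quotient [K] is the left side of [slope_derivative] times
    [x' / ((1-x)^2 y'^3)]. *)
Lemma slope_constant k D x y A t0 d : (0 < d)%R ->
  (forall t, D t -> analytic_at x t) -> (forall t, D t -> analytic_at y t) ->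
  (forall t, (Cmod (t - t0) < d)%R -> regular_point k D x y A t) ->
  exists kap : C, kap <> 0 /\ forall t, (Cmod (t - t0) < d)%R ->
    (1 - y t) * C_derive x t ^ 2 = kap * ((1 - x t) * C_derive y t ^ 2).
Proof.
  intros Hd Hx Hy Hreg.
  set (K := fun t => ((1 - y t) * C_derive x t ^ 2) * / ((1 - x t) * C_derive y t ^ 2)).
  assert (Hnz : forall t, (Cmod (t - t0) < d)%R ->
     1 - y t <> 0 /\ C_derive x t <> 0 /\ (1 - x t) * C_derive y t ^ 2 <> 0).
  { intros t Ht. destruct (Hreg t Ht) as (_ & Hg & Hx' & Hy' & _).
    apply F2_disc_neq0 in Hg as (_ & _ & N3 & N4 & _). cbn [fst snd] in *.
    repeat split; auto. apply Cmult_neq_0; auto. now apply Cpow_nz. }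
  assert (HE : forall t, (Cmod (t - t0) < d)%R ->
    y t * (1 - y t) * C_derive x t ^ 2 + 2 * (1 - x t) * (1 - y t) * C_derive x t * C_derive y t
    + x t * (1 - x t) * C_derive y t ^ 2 = 0).
  { intros t Ht. destruct (Hreg t Ht) as (_ & _ & _ & _ & lam & mu & R1 & R2 & R3 & _).
    now apply (null_direction _ _ _ _ lam mu). }
  assert (HK : forall t, (Cmod (t - t0) < d)%R -> cdiff K t 0).
  { intros t Ht. destruct (Hreg t Ht) as (HDt & Hg & Hx' & Hy' & _).
    apply F2_disc_neq0 in Hg as (_ & _ & N3 & N4 & N5). cbn [fst snd] in *.
    pose proof (analytic_at_cdiff _ _ (Hx t HDt)) as Dx1.
    pose proof (analytic_at_cdiff _ _ (Hy t HDt)) as Dy1.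
    pose proof (analytic_at_cdiff _ _ (analytic_at_C_derive _ _ (Hx t HDt))) as Dx2.
    pose proof (analytic_at_cdiff _ _ (analytic_at_C_derive _ _ (Hy t HDt))) as Dy2.
    assert (Z := slope_derivative (x t) (y t) (C_derive x t) (C_derive y t) (C_derive (C_derive x) t)
      (C_derive (C_derive y) t) (HE t Ht)).
    match type of Z with ?E' = _ -> _ => assert (HE' : E' = 0) end.
    { apply (cdiff_0_of_zero (fun t => y t * (1 - y t) * C_derive x t ^ 2
        + 2 * (1 - x t) * (1 - y t) * C_derive x t * C_derive y t + x t * (1 - x t) * C_derive y t ^ 2) t).
      - destruct (disc_nbhd t0 t d Ht) as (e & He & Ke). exists e; split; auto.
      - cdiff_auto. }
    specialize (Z HE' N3 N5 Hy').
    destruct (Hnz t Ht) as (_ & _ & N).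
    unfold K. eapply cdiff_eq.
    - apply (cdiff_mult (fun t => (1 - y t) * C_derive x t ^ 2) (fun t => / ((1 - x t) * C_derive y t ^ 2)));
        [repeat cdiff_step|apply cdiff_inv; [repeat cdiff_step|exact N]].
    - cbv beta. set (X := x t) in *. set (Y := y t) in *. set (p := C_derive x t) in *.
      set (q := C_derive y t) in *.
      set (p' := C_derive (C_derive x) t) in *. set (q' := C_derive (C_derive y) t) in *.
      match type of Z with ?z = _ => transitivity (p * z / ((1 - X) ^ 2 * q ^ 3)) end.
      + field. repeat split; auto.
      + rewrite Z. field. repeat split; auto. }
  assert (Ht0 : (Cmod (t0 - t0) < d)%R) by now rewrite Cmod_sub_diag.
  exists (K t0). split.
  - destruct (Hnz t0 Ht0) as (N1 & N2 & N3). unfold K. apply Cmult_neq_0.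
    + apply Cmult_neq_0; auto. now apply Cpow_nz.
    + intro E. apply (C1_nz). rewrite <- (Cinv_r _ N3), E. ring.
  - intros t Ht. rewrite <- (cdiff_0_const K t0 d HK t Ht). destruct (Hnz t Ht) as (_ & _ & N).
    unfold K. rewrite <- Cmult_assoc, Cinv_l, Cmult_1_r; auto.
Qed.

(** Replacing [p^2] by means of [kap] makes the null equation linear: [(y kap + x) q = -2 (1-y) p].
    Squaring it and using [kap] once more eliminates both derivatives. *)
Lemma conic_relation (x y p q kap : C) : q <> 0 -> 1 - x <> 0 ->
  y * (1 - y) * p ^ 2 + 2 * (1 - x) * (1 - y) * p * q + x * (1 - x) * q ^ 2 = 0 ->
  (1 - y) * p ^ 2 = kap * ((1 - x) * q ^ 2) ->
  (y * kap + x) ^ 2 = 4 * kap * (1 - x) * (1 - y).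
Proof.
  intros Hq Hx HE Hk.
  assert (Hl : (y * kap + x) * q = - (2) * (1 - y) * p).
  { apply C_sub_eq0, (C_cancel ((1 - x) * q)); [now apply Cmult_neq_0|]. etransitivity; [|exact HE].
    replace (y * (1 - y) * p ^ 2) with (y * ((1 - y) * p ^ 2)) by ring. rewrite Hk. ring. }
  apply C_sub_eq0, (C_cancel (q ^ 2)); [now apply Cpow_nz|].
  transitivity (((y * kap + x) * q) ^ 2 - 4 * (1 - y) * (kap * ((1 - x) * q ^ 2))); [ring|].
  rewrite Hl, <- Hk. ring.
Qed.

Lemma C_derive_ext_disc (f g : C -> C) (t0 : C) (d : R) (l : C -> C) :
  (forall t, (Cmod (t - t0) < d)%R -> f t = g t) ->
  (forall t, (Cmod (t - t0) < d)%R -> cdiff g t (l t)) ->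
  forall t, (Cmod (t - t0) < d)%R -> C_derive f t = l t.
Proof.
  intros E H t Ht. apply cdiff_C_derive. apply (cdiff_ext g); auto.
  destruct (disc_nbhd t0 t d Ht) as (e & He & K). exists e; split; auto. intros w Hw. symmetry. auto.
Qed.

Lemma F2_disc_singular (z w : C) : F2_disc (z, w) = 0 -> F2_singular (Fin z) (Fin w).
Proof.
  unfold F2_disc, F2_singular; cbn [fst snd]. intro H.
  assert (E1 : forall v : C, 1 - v = 0 -> v = 1) by (intros v E; symmetry; now apply C_sub_eq0).
  apply C_integral in H as [H|H].
  2:{ do 6 right. exists z, w. repeat split. symmetry. apply C_sub_eq0. rewrite <- H. ring. }
  apply C_integral in H as [H|H]; [|rewrite (E1 w H); tauto].
  apply C_integral in H as [H|H]; [|rewrite (E1 z H); tauto].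
  apply C_integral in H as [-> | ->]; tauto.
Qed.

Theorem theorem2p3
  (a b1 b2 c1 c2 : C)
  (hdef : F2_defined (Params a b1 b2 c1 c2))
  (D : C -> Prop) (hDopen : open D) (hDconn : connected D)
  (x y : C -> C) (hx : holomorphic D x) (hy : holomorphic D y)
  (hnonconst : exists t1 t2 : C, D t1 /\ D t2 /\ (x t1, y t1) <> (x t2, y t2))
  (f : C -> C) (hf : F2_specialization (Params a b1 b2 c1 c2) D x y f)
  (A B : C -> C) (S : list C) (hfuchs : fuchsian2 A B S)
  (hsol : solves2 A B S D f)
  (himp : fully_implied2 (Params a b1 b2 c1 c2) D x y A B) :
  (forall t, D t -> F2_singular (Fin (x t)) (Fin (y t))) \/
  represented_by (Params a b1 b2 c1 c2) D x y
    (Params a b1 b2 (2 * b1) (2 * b2)) (fun w => w) (fun w => 2 - w) \/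
  (exists s : C, s ^ 2 <> 1 /\
    represented_by (Params a b1 b2 c1 c2) D x y
      (Params (b1 + b2 - 1 / 2) b1 b2 (2 * b1) (2 * b2))
      (fun w => 1 - w ^ 2) (fun w => 1 - (w + s) ^ 2 / (s ^ 2 - 1))).
Proof.
  destruct (classic (exists t, D t /\ F2_disc (x t, y t) <> 0)) as [Hns|Hs].
  2:{ left. intros t Ht. apply F2_disc_singular. apply NNPP. intro Q. apply Hs. now exists t. }
  right.
  pose proof (proj1 (holomorphic_analytic D x) hx) as Hx.
  pose proof (proj1 (holomorphic_analytic D y) hy) as Hy.
  destruct (regular_disc_exists _ D x y A B hDopen hDconn Hx Hy hnonconst himp Hns) as (t0 & d & Hd & Hreg).
  destruct (slope_constant _ D x y A t0 d Hd Hx Hy Hreg) as (kap & Hkap & Hslope).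
  assert (Ht0 : (Cmod (t0 - t0) < d)%R) by now rewrite Cmod_sub_diag.
  (* The conic is free of derivatives, so it extends from the disc to all of [D]. *)
  assert (Hconic : forall t, D t -> (y t * kap + x t) ^ 2 = 4 * kap * (1 - x t) * (1 - y t)).
  { intros t Ht. apply C_sub_eq0.
    apply (identity_theorem D (fun t => (y t * kap + x t) ^ 2 - 4 * kap * (1 - x t) * (1 - y t))
      hDconn); auto.
    - apply holomorphic_analytic. intros w Hw. specialize (Hx w Hw). specialize (Hy w Hw). analytic_auto.
    - exists t0, d. split; [now destruct (Hreg t0 Ht0)|]. split; auto. intros w Hw.
      destruct (Hreg w Hw) as (_ & Hg & Hx' & Hy' & lam & mu & R1 & R2 & R3 & _).
      apply F2_disc_neq0 in Hg as (_ & _ & N3 & _). cbn [fst snd] in *.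
      rewrite (conic_relation _ _ _ _ kap Hy' N3 (null_direction _ _ _ _ lam mu R1 R2 R3) (Hslope w
        Hw)). ring. }
  assert (HD : forall t, (Cmod (t - t0) < d)%R -> D t) by (intros t Ht; now destruct (Hreg t Ht)).
  destruct (C_sqrt_exists (kap + 1)) as [s Hs].
  assert (Ekap : kap = s ^ 2 - 1) by (rewrite Hs; ring).
  destruct (classic (s = 0)) as [Hs0|Hs0].
  - left.
    (* For [kap = -1] the conic degenerates to the double line [(x + y - 2)^2 = 0]. *)
    assert (Exy : forall t, D t -> y t = 2 - x t).
    { intros t Ht. specialize (Hconic t Ht). rewrite Ekap, Hs0 in Hconic.
      assert (E : (x t + y t - 2) * (x t + y t - 2) = 0).
      { match type of Hconic with ?l = ?r => transitivity (l - r); [ring|rewrite Hconic; ring] end. }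
      apply C_sub_eq0. apply C_integral in E as [E|E]; rewrite <- E; ring. }
    assert (E1 : forall t, (Cmod (t - t0) < d)%R -> C_derive y t = - C_derive x t).
    { apply (C_derive_ext_disc y (fun t => 2 - x t)); auto. intros t Ht.
      pose proof (analytic_at_cdiff _ _ (Hx t (HD t Ht))). cdiff_auto. }
    assert (E2 : forall t, (Cmod (t - t0) < d)%R -> C_derive (C_derive y) t = - C_derive (C_derive x) t).
    { apply (C_derive_ext_disc (C_derive y) (fun t => - C_derive x t)); auto. intros t Ht.
      pose proof (analytic_at_cdiff _ _ (analytic_at_C_derive _ _ (Hx t (HD t Ht)))). cdiff_auto. }
    (* Coefficients of [param_relation_diag] in powers of [x], which serves as the parameter of the
       line. *)
    assert (Hp : List.Forall (fun c : C => c = 0) (2 * (c1 - 2 * b1) :: (- (c1 - 2 * b1) - (c2 - 2 *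
      b2)) :: nil)).
    { apply (peval_zero_on_disc x (C_derive x) t0 d Hd).
      - intros t Ht. destruct (Hreg t Ht) as (HDt & _ & Hx' & _). split; auto using analytic_at_cdiff.
      - intros t Ht. destruct (Hreg t Ht) as (HDt & _ & Hx' & _ & lam & mu & R1 & R2 & _ & R4 & R5).
        cbn [pa pb1 pb2 pc1 pc2] in *.
        rewrite <- (param_relation_diag a b1 b2 c1 c2 (x t) (y t) _ _ _ _ (A t) lam mu (Exy t HDt) (E1 t
          Ht) (E2 t Ht) R1 R2 R4 R5 Hx').
        simpl. ring. }
    inversion Hp as [|? ? P1 Hp']; subst. inversion Hp' as [|? ? P2 _]; subst.
    apply C_cancel in P1; [|apply RtoC_neq0; lra]. rewrite P1 in P2.
    assert (F1 : c1 = 2 * b1) by now apply C_sub_eq0.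
    assert (F2 : c2 = 2 * b2).
    { apply C_sub_eq0. transitivity (- (- (0) - (c2 - 2 * b2))); [ring|]. rewrite P2. ring. }
    split; [now rewrite F1, F2|]. exists x. split; [exact hx|]. split; [|auto].
    destruct hnonconst as (t1 & t2 & H1 & H2 & Hne). exists t1, t2. repeat split; auto.
    intro E. apply Hne. now rewrite (Exy t1 H1), (Exy t2 H2), E.
  - right. exists s.
    assert (H2s : 2 * s <> 0) by (apply Cmult_neq_0; auto; apply RtoC_neq0; lra).
    (* Obtained by subtracting [1 - x = psi^2] from [kap (1 - y) = (psi + s)^2], which leaves
       [2 s psi + s^2]. Thus [psi] is analytic on [D] without any choice of a square root of
       [1 - x]. *)
    set (psi := fun t => ((1 - y t) * kap - (1 - x t) - s ^ 2) * / (2 * s)).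
    assert (Hpsi : forall t, D t -> analytic_at psi t).
    { intros t Ht. specialize (Hx t Ht). specialize (Hy t Ht). unfold psi. analytic_auto. }
    assert (Ex : forall t, D t -> x t = 1 - psi t ^ 2).
    { intros t Ht. specialize (Hconic t Ht). apply C_sub_eq0.
      match type of Hconic with ?l = ?r => transitivity ((l - r) / (2 * s) ^ 2) end.
      - unfold psi. rewrite Ekap. field. auto.
      - rewrite Hconic. field. auto. }
    assert (Ey : forall t, D t -> (s ^ 2 - 1) * (1 - y t) = (psi t + s) ^ 2).
    { intros t Ht. transitivity (psi t ^ 2 + 2 * s * psi t + s ^ 2); [|ring].
      replace (psi t ^ 2) with (1 - x t) by (rewrite (Ex t Ht) at 1; ring).
      unfold psi. rewrite Ekap. field. auto. }
    rewrite Ekap in Hkap.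
    assert (Ey' : forall t, D t -> y t = 1 - (psi t + s) ^ 2 / (s ^ 2 - 1)).
    { intros t Ht. rewrite <- (Ey t Ht). field. exact Hkap. }
    split; [intro E; apply Hkap; rewrite E; ring|].
    assert (P1 : forall t, (Cmod (t - t0) < d)%R -> cdiff psi t (C_derive psi t))
      by (intros t Ht; apply analytic_at_cdiff, Hpsi, HD, Ht).
    assert (P2 : forall t, (Cmod (t - t0) < d)%R -> cdiff (C_derive psi) t (C_derive (C_derive psi) t))
      by (intros t Ht; apply analytic_at_cdiff, analytic_at_C_derive, Hpsi, HD, Ht).
    assert (X1 : forall t, (Cmod (t - t0) < d)%R -> C_derive x t = - (2) * psi t * C_derive psi t).
    { apply (C_derive_ext_disc x (fun t => 1 - psi t ^ 2)); auto. intros t Ht. specialize (P1 t Ht).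
      cdiff_auto. }
    assert (X2 : forall t, (Cmod (t - t0) < d)%R ->
      C_derive (C_derive x) t = - (2) * (C_derive psi t ^ 2 + psi t * C_derive (C_derive psi) t)).
    { apply (C_derive_ext_disc _ (fun t => - (2) * psi t * C_derive psi t)); auto. intros t Ht.
      specialize (P1 t Ht). specialize (P2 t Ht). cdiff_auto. }
    assert (Y1 : forall t, (Cmod (t - t0) < d)%R ->
      C_derive y t = / (s ^ 2 - 1) * (- (2) * (psi t + s) * C_derive psi t)).
    { apply (C_derive_ext_disc y (fun t => 1 - / (s ^ 2 - 1) * (psi t + s) ^ 2)); auto.
      - intros t Ht. rewrite (Ey' t (HD t Ht)). unfold Cdiv. ring.
      - intros t Ht. specialize (P1 t Ht). cdiff_auto. }
    assert (Y2 : forall t, (Cmod (t - t0) < d)%R -> C_derive (C_derive y) t =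
      / (s ^ 2 - 1) * (- (2) * (C_derive psi t ^ 2 + (psi t + s) * C_derive (C_derive psi) t))).
    { apply (C_derive_ext_disc _ (fun t => / (s ^ 2 - 1) * (- (2) * (psi t + s) * C_derive psi t)));
        auto. intros t Ht.
      specialize (P1 t Ht). specialize (P2 t Ht). cdiff_auto. }
    (* The list [Hp] below holds the coefficients of [param_relation] in powers of [psi], linear in
       the three defects [g1], [g2], [g3]. *)
    set (g1 := c1 - 2 * b1). set (g2 := (c2 - 2 * b2) * (s ^ 2 - 1)).
    set (g3 := s * (1 / 2 - (a + 1 - b1 - b2))).
    assert (Hp : List.Forall (fun c : C => c = 0)
      ((s * g1 + g3) :: ((1 + 2 * s ^ 2) * g1 + g2 + 2 * s * g3) :: (3 * s * g1) ::
       (g1 - g2 - 2 * s * g3) :: - g3 :: nil)).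
    { apply (peval_zero_on_disc psi (C_derive psi) t0 d Hd).
      - intros t Ht. split; auto. destruct (Hreg t Ht) as (_ & _ & Hx' & _).
        intro E. apply Hx'. rewrite (X1 t Ht), E. ring.
      - intros t Ht. destruct (Hreg t Ht) as (HDt & Hg & Hx' & Hy' & lam & mu & R1 & R2 & _ & R4 & R5).
        apply F2_disc_neq0 in Hg as (N1 & N2 & N3 & N4 & _). cbn [fst snd pa pb1 pb2 pc1 pc2] in *.
        rewrite <- (param_relation a b1 b2 c1 c2 (x t) (y t) (C_derive x t) (C_derive y t)
          (C_derive (C_derive x) t) (C_derive (C_derive y) t) (A t) lam mu (psi t) s (C_derive psi t)
            (C_derive (C_derive psi) t));
          auto.
        + simpl. unfold g1, g2, g3. field.
        + rewrite (Y1 t Ht). field. exact Hkap.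
        + rewrite (Y2 t Ht). field. exact Hkap.
        + intro E. apply Hx'. rewrite (X1 t Ht), E. ring.
        + intro E. apply Hy'. rewrite (Y1 t Ht), E. ring.
        + intro E. apply Hx'. rewrite (X1 t Ht), E. ring. }
    inversion Hp as [|? ? Q0 Hp1]; subst. inversion Hp1 as [|? ? Q1 Hp2]; subst.
    inversion Hp2 as [|? ? _ Hp3]; subst. inversion Hp3 as [|? ? _ Hp4]; subst.
    inversion Hp4 as [|? ? Q4 _]; subst.
    (* Degrees 4, 0 and 1 give [g3], [g1] and [g2] in turn; [s <> 0] is used for [g1] and again for
       the value of [a]. *)
    assert (G3 : g3 = 0) by (replace g3 with (- - g3) by ring; rewrite Q4; ring).
    assert (G1 : g1 = 0) by (apply (C_cancel s); auto; rewrite <- Q0, G3; ring).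
    assert (G2 : g2 = 0) by (rewrite <- Q1, G1, G3; ring).
    assert (F1 : c1 = 2 * b1) by now apply C_sub_eq0.
    assert (F2 : c2 = 2 * b2).
    { apply C_sub_eq0, (C_cancel (s ^ 2 - 1)); auto. rewrite <- G2. unfold g2. ring. }
    assert (F3 : a = b1 + b2 - 1 / 2).
    { unfold g3 in G3. apply C_cancel in G3; auto. symmetry. apply C_sub_eq0. rewrite <- G3. field. }
    split; [now rewrite F1, F2, F3|]. exists psi. split; [now apply holomorphic_analytic|]. split; [|auto].
    destruct hnonconst as (t1 & t2 & H1 & H2 & Hne). exists t1, t2. repeat split; auto.
    intro E. apply Hne. now rewrite (Ex t1 H1), (Ex t2 H2), (Ey' t1 H1), (Ey' t2 H2), E.
Qed.
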